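(* Let $\mathbb{G}$ be a stratified group with first layer $V_1$, equipped with a homogeneous distance $d$, and let $\mathbb{M}$ be a Banach homogeneous group equipped with its Banach homogeneous distance $\rho$. Let $A\subset\mathbb{G}$ be measurable and let $f\colon A\to\mathbb{M}$ be Lipschitz. Then there is a $\sigma$-porous set $P\subset\mathbb{G}$ such that for every $x\in (A\cap D(A))\setminus P$ the following holds: if there is a spanning set of directions $v_1,\dots,v_N\in V_1$ such that $f$ is differentiable at $x$ in direction $v_i$ for every $i=1,\dots,N$, then $f$ is (h-)differentiable at $x$.
   Context: **Banach homogeneous groups.** A Banach Lie algebra is a (real) Banach space $\mathbb{M}$ with norm $|\cdot|$ and a continuous, bilinear, skew-symmetric bracket $[\cdot,\cdot]$ satisfying the Jacobi identity. It is nilpotent of step $\nu\in\mathbb{N}$ if all iterated left-nested brackets of $\nu+1$ elements vanish and some iterated left-nested bracket of $\nu$ elements is nonzero. It carries the group operation $xy=x+y+\sum_{m=2}^{\nu}P_m(x,y)$ given by the truncated Baker-Campbell-Hausdorff series ($P_m$ is the homogeneous term of degree $m$, written with iterated brackets; e.g. $P_2(x,y)=[x,y]/2$); the identity is $0$ and $x^{-1}=-x$. $\mathbb{M}$ is a Banach homogeneous group if there are closed subspaces $H_1,\dots,H_\nu$ with $\mathbb{M}=H_1\oplus\cdots\oplus H_\nu$ (the sum map $H_1\times\cdots\times H_\nu\to\mathbb{M}$ is a continuous linear bijection), $[x,y]\in H_{i+j}$ for $x\in H_i,y\in H_j$, $i+j\le\nu$, and $[x,y]=0$ if $i+j>\nu$.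 Let $\pi_i\colon\mathbb{M}\to H_i$ be the projections. Dilations $\delta_r$, $r>0$, are the linear maps acting as multiplication by $r^i$ on $H_i$ (and $\delta_0=0$). Fixed positive constants $\sigma_1=1,\sigma_2,\dots,\sigma_\nu$ are chosen so that the Banach homogeneous norm $\|x\|=\max_{1\le i\le\nu}\sigma_i|\pi_i(x)|^{1/i}$ satisfies $\|xy\|\le\|x\|+\|y\|$ (such constants exist); the Banach homogeneous distance is $\rho(x,y)=\|x^{-1}y\|$. **Stratified groups.** A stratified group $\mathbb{G}$ is a finite dimensional Banach homogeneous group, with layers $\mathbb{G}=V_1\oplus\cdots\oplus V_s$, such that $[V_1,V_j]=V_{j+1}$ for $j\ge1$ and $V_j=\{0\}$ for $j>s$. A homogeneous distance $d$ on $\mathbb{G}$ is a distance with $d(zx,zy)=d(x,y)$ and $d(\delta_rx,\delta_ry)=r\,d(x,y)$ for all $x,y,z\in\mathbb{G}$, $r>0$; write $d(x)=d(x,0)$. $\mu$ denotes a Haar measure on $\mathbb{G}$. ''Measurable'' refers to $\mu$, and ''Lipschitz'' refers to $d$ and $\rho$. **Spanning set of directions.** $v_1,\dots,v_N\in V_1$ ($N\in\mathbb{N}$) is a spanning set of directions if there is $T>0$ such that $\{\delta_{t_1}v_1\delta_{t_2}v_2\cdots\delta_{t_N}v_N:0\le t_i<T\}$ contains the unit ball of $\mathbb{G}$ (with respect to $d$, centred at $0$). **Density points.** $D(A)$ is the set of $x\in\mathbb{G}$ with $\lim_{r\downarrow0}\mu(A\cap B(x,r))/\mu(B(x,r))=1$,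 where $B(x,r)$ is the open $d$-ball. **Directional derivatives.** Points $\zeta_x^t\in\mathbb{G}$, $t>0$, approximate in $A$ the direction $\zeta\in\mathbb{G}$ at $x$ if $x\zeta_x^t\in A$ for every $t>0$ and $d(\zeta_x^t,\delta_t\zeta)/t\to0$ as $t\downarrow0$. Let $f\colon A\to\mathbb{M}$, $x\in A$, and suppose there exist points approximating in $A$ the direction $\zeta$ at $x$. Then $f$ is differentiable at $x$ in direction $\zeta$, with directional derivative $\partial^+f(x,\zeta)\in\mathbb{M}$, if for every choice $t\mapsto\zeta_x^t$ of points approximating in $A$ the direction $\zeta$ at $x$ one has $\lim_{t\downarrow0}\delta_{1/t}\big(f(x)^{-1}f(x\zeta_x^t)\big)=\partial^+f(x,\zeta)$. The same definition is used for $\zeta=0$. **Homogeneous homomorphisms and differentiability.** A homogeneous homomorphism (h-homomorphism) is a map $L\colon\mathbb{G}\to\mathbb{M}$ with $L(xy)=L(x)L(y)$ and $L(\delta_rx)=\delta_r(L(x))$ for all $x,y\in\mathbb{G}$, $r>0$. For $x\in A\cap D(A)$, $f\colon A\to\mathbb{M}$ is h-differentiable (or simply differentiable) at $x$ if there is an h-homomorphism $L\colon\mathbb{G}\to\mathbb{M}$ with $\rho(f(x)^{-1}f(xz),L(z))/d(z)\to0$ as $z\in x^{-1}A$, $d(z)\downarrow0$. **Porosity.** A set $E$ in a metric space $(M,\varrho)$ is porous at $a\in M$ with constant $\Lambda>0$ if there is a sequence $x_n\to a$ with $B(x_n,\Lambda\varrho(a,x_n))\cap E=\emptyset$ for every $n\in\mathbb{N}$.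 $E$ is porous if it is porous at each $a\in E$ with $\Lambda$ independent of $a$; $E$ is $\sigma$-porous if it is a countable union of porous sets. In $\mathbb{G}$ these notions refer to $d$. *)

(* Defs.v *)
From HB Require Import structures.
From mathcomp Require Import all_boot all_order all_algebra.
From mathcomp Require Import all_classical all_reals all_analysis.

Set Implicit Arguments.
Unset Strict Implicit.
Unset Printing Implicit Defensive.

Import Order.TTheory GRing.Theory Num.Theory.
Import numFieldNormedType.Exports.

Local Open Scope classical_set_scope.
Local Open Scope ring_scope.

Definition linear_subspace (R : realType) (V : lmodType R) (S : set V) : Prop :=
  S 0 /\ forall (a : R) (u v : V), S u -> S v -> S (a *: u + v).

Definition linear_span (R : realType) (V : lmodType R) (S : set V) : set V :=
  smallest (@linear_subspace R V) S.

Definition finite_dimensional (R : realType) (V : lmodType R) : Prop :=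
  exists (n : nat) (e : 'I_n -> V), forall x : V,
  exists c : 'I_n -> R, x = \sum_(i < n) c i *: e i.

Section BakerCampbellHausdorff.
Context {R : realType} {V : lmodType R} (br : V -> V -> V).

(* [:: a1; a2; ...; am] |-> [...[[a1, a2], a3], ..., am] *)
Definition left_bracket (w : seq V) : V :=
  if w is a :: w' then foldl br a w' else 0.

Definition nilpotent_of_step (nu : nat) : Prop :=
  [/\ (0 < nu)%N,
      forall w : seq V, size w = nu.+1 -> left_bracket w = 0 &
      exists w : seq V, size w = nu /\ left_bracket w != 0].

(* x^p_1 y^q_1 ... x^p_k y^q_k *)
Definition bch_word (k m : nat) (p q : {ffun 'I_k -> 'I_m.+1}) (x y : V) :
  seq V := flatten [seq nseq (p i) x ++ nseq (q i) y | i <- enum 'I_k].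

Definition bch_index (k m : nat) (p q : {ffun 'I_k -> 'I_m.+1}) : bool :=
  [forall i, 0 < p i + q i]%N && (\sum_i (p i + q i) == m)%N.

(* Dynkin's form of the homogeneous part of degree m of log (exp x exp y):
   1/m sum_(1 <= k <= m) (-1)^(k-1)/k
       sum_(p_i + q_i > 0, sum_i (p_i + q_i) = m)
         [x^p_1 y^q_1 ... x^p_k y^q_k] / (p_1! q_1! ... p_k! q_k!). *)
Definition bch_term (m : nat) (x y : V) : V :=
  m%:R^-1 *: \sum_(1 <= k < m.+1) ((-1) ^+ k.-1 / k%:R) *:
    \sum_(p : {ffun 'I_k -> 'I_m.+1})
      \sum_(q : {ffun 'I_k -> 'I_m.+1} | bch_index p q)
        (\prod_i ((p i)`! * (q i)`!)%N%:R)^-1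
        *: left_bracket (bch_word p q x y).

Definition bch (nu : nat) (x y : V) : V :=
  x + y + \sum_(2 <= m < nu.+1) bch_term m x y.

End BakerCampbellHausdorff.

(* The layers are [layer 1, ..., layer step], extended by {0} beyond [step];
   [layer 0] and [proj 0] carry no meaning. The axioms on [proj] say that
   x |-> (proj 1 x, ..., proj step x) is the two-sided inverse of the sum map
   H_1 x ... x H_step -> M. *)
Record bhGroup (R : realType) := BHGroup {
  bh_space :> completeNormedModType R;
  bracket : {bilinear bh_space -> bh_space -> bh_space};
  step : nat;
  layer : nat -> set bh_space;
  proj : nat -> bh_space -> bh_space;
  bracket_continuous :
    continuous (fun xy : bh_space * bh_space => bracket xy.1 xy.2);
  bracket_skew : forall x y : bh_space, bracket x y = - bracket y x;
  bracket_jacobi : forall x y z : bh_space,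
    bracket x (bracket y z) + bracket y (bracket z x)
      + bracket z (bracket x y) = 0;
  bracket_nilpotent : nilpotent_of_step bracket step;
  layer_subspace : forall i, (1 <= i <= step)%N -> linear_subspace (layer i);
  layer_closed : forall i, (1 <= i <= step)%N -> closed (layer i);
  layer_gt_step : forall i, (step < i)%N -> layer i = [set 0];
  proj_layer : forall i (x : bh_space), (1 <= i <= step)%N ->
    layer i (proj i x);
  proj_sum : forall x : bh_space, \sum_(1 <= i < step.+1) proj i x = x;
  proj_unique : forall u : nat -> bh_space,
    (forall i, (1 <= i <= step)%N -> layer i (u i)) ->
    forall i, (1 <= i <= step)%N ->
    proj i (\sum_(1 <= j < step.+1) u j) = u i;
  bracket_layer : forall (i j : nat) (x y : bh_space),
    (1 <= i)%N -> (1 <= j)%N -> (i + j <= step)%N ->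
    layer i x -> layer j y -> layer (i + j) (bracket x y);
  bracket_layer0 : forall (i j : nat) (x y : bh_space),
    (1 <= i <= step)%N -> (1 <= j <= step)%N -> (step < i + j)%N ->
    layer i x -> layer j y -> bracket x y = 0
}.

Arguments bracket {R} b.
Arguments layer {R} b i.
Arguments proj {R b} i x.

Section BHGroupTheory.
Context {R : realType} (M : bhGroup R).

Definition gmul (x y : M) : M := bch (bracket M) (step M) x y.

Definition ginv (x : M) : M := - x.

(* For r = 0 this is the zero map. *)
Definition dil (r : R) (x : M) : M :=
  \sum_(1 <= i < (step M).+1) r ^+ i *: proj i x.

Definition bh_norm (sigma : nat -> R) (x : M) : R :=
  \big[Num.max/0]_(1 <= i < (step M).+1) (sigma i * `|proj i x| `^ i%:R^-1).

Definition norm_constants (sigma : nat -> R) : Prop :=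
  [/\ sigma 1%N = 1,
      forall i, (1 <= i <= step M)%N -> 0 < sigma i &
      forall x y : M,
        bh_norm sigma (gmul x y) <= bh_norm sigma x + bh_norm sigma y].

Definition bh_dist (sigma : nat -> R) (x y : M) : R :=
  bh_norm sigma (gmul (ginv x) y).

End BHGroupTheory.

Definition stratified (R : realType) (G : bhGroup R) : Prop :=
  finite_dimensional G /\
  forall j, (1 <= j)%N ->
    linear_span [set bracket G x y | x in layer G 1 & y in layer G j]
    = layer G j.+1.

Definition dball (R : realType) (T : Type) (d : T -> T -> R) (x : T) (r : R) :
  set T := [set y | d x y < r].

(* The points x_n are required to differ from a: otherwise the constant
   sequence a, for which the open ball below is empty, would make every set
   porous. *)
Definition porous_at (R : realType) (T : Type) (d : T -> T -> R) (E : set T)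
    (lambda : R) (a : T) : Prop :=
  exists x : nat -> T,
    [/\ forall n, x n <> a,
        d a (x n) @[n --> \oo] --> 0 &
        forall n, dball d (x n) (lambda * d a (x n)) `&` E = set0].

Definition porous (R : realType) (T : Type) (d : T -> T -> R) (E : set T) :
  Prop := exists2 lambda : R, 0 < lambda &
    forall a, E a -> porous_at d E lambda a.

Definition sigma_porous (R : realType) (T : Type) (d : T -> T -> R)
    (P : set T) : Prop :=
  exists2 E : nat -> set T, forall n, porous d (E n) & P = \bigcup_n E n.

Definition borelType (T : topologicalType) := g_sigma_algebraType (@open T).

Section StratifiedGroup.
Context {R : realType} (G : bhGroup R).

Definition homogeneous_distance (d : G -> G -> R) : Prop :=
  [/\ (forall x y, 0 <= d x y) /\ (forall x y, d x y = 0 <-> x = y),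
      forall x y, d x y = d y x,
      forall x y z, d x z <= d x y + d y z,
      forall x y z, d (gmul z x) (gmul z y) = d x y &
      forall (r : R) x y, 0 < r -> d (dil r x) (dil r y) = r * d x y].

(* Nonzero, left invariant, finite on compact sets; regularity is automatic
   for such Borel measures on a finite dimensional space. *)
Definition haar_measure (mu : {measure set (borelType G) -> \bar R}) : Prop :=
  [/\ mu setT <> 0%E,
      forall K : set G, compact K -> (mu K < +oo)%E &
      forall (z : G) (B : set (borelType G)), measurable B ->
        mu [set gmul z y | y in B] = mu B].

(* A belongs to the mu-completion of the Borel sigma-algebra: since mu is
   sigma-finite, these are the Caratheodory measurable sets of the outer
   measure mu^*, on which the completion of mu is mu^*. *)
Definition mu_measurable (mu : {measure set (borelType G) -> \bar R})
  (A : set G) : Prop := (mu^*)%mu.-cara.-measurable A.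

Definition density_point (d : G -> G -> R)
    (mu : {measure set (borelType G) -> \bar R}) (A : set G) : set G :=
  [set x | fine ((mu^*)%mu (A `&` dball d x r)) / fine (mu (dball d x r))
             @[r --> 0^'+] --> (1 : R)].

Definition spanning_directions (d : G -> G -> R) (N : nat) (v : 'I_N -> G) :
  Prop :=
  (forall i, layer G 1 (v i)) /\
  exists2 T : R, 0 < T &
    dball d 0 1 `<=`
      [set \big[@gmul R G/0]_(i < N) dil (t i) (v i) |
         t in [set t : 'I_N -> R | forall i, 0 <= t i < T]].

(* The values of z at t <= 0 are irrelevant. *)
Definition approximates (d : G -> G -> R) (A : set G) (x zeta : G)
    (z : R -> G) : Prop :=
  (forall t : R, 0 < t -> A (gmul x (z t))) /\
  d (z t) (dil t zeta) / t @[t --> 0^'+] --> (0 : R).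

Variable M : bhGroup R.

(* Maps A -> M are represented by maps G -> M, whose values are only ever used
   on A. *)
Definition lipschitz_within (d : G -> G -> R) (rho : M -> M -> R) (A : set G)
    (f : G -> M) : Prop :=
  exists C : R, forall x y, A x -> A y -> rho (f x) (f y) <= C * d x y.

(* The limit is taken in the Banach space M, whose norm topology is also the
   topology of the Banach homogeneous distance. *)
Definition directional_derivative (d : G -> G -> R) (A : set G) (f : G -> M)
    (x zeta : G) (D : M) : Prop :=
  forall z, approximates d A x zeta z ->
    dil t^-1 (gmul (ginv (f x)) (f (gmul x (z t)))) @[t --> 0^'+] --> D.

Definition directionally_differentiable (d : G -> G -> R) (A : set G)
    (f : G -> M) (x zeta : G) : Prop :=
  (exists z, approximates d A x zeta z) /\
  exists D, directional_derivative d A f x zeta D.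

Definition h_homomorphism (L : G -> M) : Prop :=
  (forall x y, L (gmul x y) = gmul (L x) (L y)) /\
  (forall (r : R) x, 0 < r -> L (dil r x) = dil r (L x)).

Definition h_differentiable (d : G -> G -> R) (rho : M -> M -> R) (A : set G)
    (f : G -> M) (x : G) : Prop :=
  exists2 L : G -> M, h_homomorphism L &
    forall eps : R, 0 < eps -> exists2 eta : R, 0 < eta &
      forall z, A (gmul x z) -> 0 < d z 0 < eta ->
        rho (gmul (ginv (f x)) (f (gmul x z))) (L z) / d z 0 < eps.

End StratifiedGroup.

(* Main.v *)
From HB Require Import structures.
Require Import Defs.
From mathcomp Require Import all_boot all_order all_algebra.
From mathcomp Require Import all_classical all_reals all_analysis.
From mathcomp Require Import ring lra zify.
(* Restores [proj], which all_analysis shadows. *)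
Import Defs.

(* If [f] has, uniformly at small scales, derivative [a] at [x] in the direction
   [zeta] and [b] in the direction [eta], then x (dil t zeta) is within [o(t)] of
   points [x'] at which [f] still has derivative almost [b] in the direction [eta]
   at scale [t], unless the set of such points is porous at [x]; following
   [zeta] and then [eta] through [x'] gives the derivative [a b] in the direction
   [zeta eta]. By separability countably many such sets suffice, and [P] collects
   their porosity points together with those of [A]. Directions multiply up from
   a spanning set to all of [G], the derivative is then a homogeneous
   homomorphism, and total boundedness of balls makes the approximation uniform.

   The group axioms require that the product defined by Dynkin's series is
   associative. The adjoint representation extended by the degree derivation is
   faithful and nilpotent, so it suffices that log (exp X exp Y) is given by
   Dynkin's series for nilpotent [X], [Y] in an associative algebra. For a
   derivation [delta] fixing [X] and [Y], and g = exp X exp Y, one has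
   delta (g ^ n) = g ^ n s_n with both sides polynomial in [n]; comparing the
   coefficients of [n] computes delta (log g) as Dynkin's sum of brackets. *)

Set Implicit Arguments.
Unset Strict Implicit.
Unset Printing Implicit Defensive.

Import Order.TTheory GRing.Theory Num.Theory.
Import numFieldNormedType.Exports.

Local Open Scope classical_set_scope.
Local Open Scope ring_scope.

(** * Operator and polynomial algebras *)

(** Two obstacles shape the analysis. [M] need not be separable, so the countable family cannot run
    over a dense set of possible derivatives. But a derivative is a limit of rescaled increments of
    [f], and the increments between points of a dense sequence in [A] suffice. Moreover the
    distances are only left invariant, so an error in the middle of a product costs a conjugation,
    whose continuity at 0 has to be proved. In [M] it comes from the boundedness of the projections,
    an open mapping argument. In [G] the distance is abstract, and its balls are known only through
    dilations and the triangle inequality. The spanning directions reduce the question to polynomial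
    curves, along which homogeneity and subadditivity are enough, and total boundedness and
    separability are obtained in the same way.

    The algebra rests on one device used twice: adjoining a vector e to a Lie algebra. With [e, a] =
    a, operators evaluated at e give left-nested brackets and e imitates the derivation [delta].
    With [e, a] the degree operator at a, the kernel of the adjoint representation disappears. *)

Section RightOperators.
Context {R : realType} (V : lmodType R).
(** The factor [R^o] carries the adjoined vector e = (0, 1). It also makes the operator ring
    nontrivial when [V] is zero. *)
Local Notation W := (V * R^o)%type.

(* The product is [f * g = g \o f], so that words act from left to right like
   left-nested brackets. *)
Record rop := ROp { rop_fun :> W -> W; rop_linear : linear rop_fun }.

HB.instance Definition _ := gen_eqMixin rop.
HB.instance Definition _ := gen_choiceMixin rop.

Lemma rop_ext (f g : rop) : f =1 g -> f = g.
Proof.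
case: f g => [f fl] [g gl] /= /funext fg; rewrite fg in fl *.
by congr ROp; exact: Prop_irrelevance.
Qed.

Lemma rop0_subproof : linear (fun _ : W => 0 : W).
Proof. by move=> a u v; rewrite scaler0 addr0. Qed.
Lemma rop1_subproof : linear (fun w : W => w).
Proof. by []. Qed.
Lemma ropD_subproof (f g : rop) : linear (fun w => f w + g w).
Proof. by move=> a u v; rewrite !rop_linear scalerDr addrACA. Qed.
Lemma ropN_subproof (f : rop) : linear (fun w => - f w).
Proof. by move=> a u v; rewrite rop_linear opprD scalerN. Qed.
Lemma ropM_subproof (f g : rop) : linear (fun w => g (f w)).
Proof. by move=> a u v; rewrite !rop_linear. Qed.
Lemma ropZ_subproof (k : R) (f : rop) : linear (fun w => k *: f w).
Proof.
by move=> a u v; rewrite rop_linear scalerDr !scalerA [k * a]mulrC.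
Qed.

Let rop0 := ROp rop0_subproof.
Let rop1 := ROp rop1_subproof.
Let ropD f g := ROp (ropD_subproof f g).
Let ropN f := ROp (ropN_subproof f).
Let ropM f g := ROp (ropM_subproof f g).
Let ropZ k f := ROp (ropZ_subproof k f).

Lemma ropDA : associative ropD.
Proof. by move=> f g h; apply: rop_ext => w /=; rewrite addrA. Qed.
Lemma ropDC : commutative ropD.
Proof. by move=> f g; apply: rop_ext => w /=; rewrite addrC. Qed.
Lemma rop0D : left_id rop0 ropD.
Proof. by move=> f; apply: rop_ext => w /=; rewrite add0r. Qed.
Lemma ropND : left_inverse rop0 ropN ropD.
Proof. by move=> f; apply: rop_ext => w /=; rewrite addNr. Qed.

HB.instance Definition _ := GRing.isZmodule.Build rop ropDA ropDC rop0D ropND.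

Lemma ropMA : associative ropM.
Proof. by move=> f g h; apply: rop_ext. Qed.
Lemma rop1M : left_id rop1 ropM.
Proof. by move=> f; apply: rop_ext. Qed.
Lemma ropM1 : right_id rop1 ropM.
Proof. by move=> f; apply: rop_ext. Qed.
Lemma ropMDl : left_distributive ropM +%R.
Proof.
move=> f g h; apply: rop_ext => w /=.
by have := rop_linear h 1 (f w) (g w); rewrite !scale1r.
Qed.
Lemma ropMDr : right_distributive ropM +%R.
Proof. by move=> f g h; apply: rop_ext. Qed.
Lemma rop1_neq0 : rop1 != 0 :> rop.
Proof.
apply/eqP => /(congr1 (fun f : rop => (f (0, 1)).2)) /= /eqP.
by rewrite oner_eq0.
Qed.

HB.instance Definition _ :=
  GRing.Zmodule_isNzRing.Build rop ropMA rop1M ropM1 ropMDl ropMDr rop1_neq0.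

Lemma ropZA (a b : R) f : ropZ a (ropZ b f) = ropZ (a * b) f.
Proof. by apply: rop_ext => w /=; rewrite scalerA. Qed.
Lemma rop1Z : left_id 1 ropZ.
Proof. by move=> f; apply: rop_ext => w /=; rewrite scale1r. Qed.
Lemma ropZDr : right_distributive ropZ +%R.
Proof. by move=> a f g; apply: rop_ext => w /=; rewrite scalerDr. Qed.
Lemma ropZDl f : {morph ropZ^~ f : a b / a + b}.
Proof. by move=> a b; apply: rop_ext => w /=; rewrite scalerDl. Qed.

HB.instance Definition _ :=
  GRing.Zmodule_isLmodule.Build R rop ropZA rop1Z ropZDr ropZDl.

Lemma ropZAl (a : R) (f g : rop) : a *: (f * g) = a *: f * g.
Proof.
apply: rop_ext => w /=.
have g0 : g 0 = 0.
  by have := rop_linear g (-1) 0 0; rewrite !scaleN1r oppr0 addr0 addNr.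
by have := rop_linear g a (f w) 0; rewrite !addr0 g0 addr0.
Qed.
HB.instance Definition _ := GRing.Lmodule_isLalgebra.Build R rop ropZAl.

Lemma ropZAr (a : R) (f g : rop) : a *: (f * g) = f * (a *: g).
Proof. by apply: rop_ext. Qed.
HB.instance Definition _ := GRing.Lalgebra_isAlgebra.Build R rop ropZAr.

Lemma ropDE (f g : rop) w : (f + g) w = f w + g w. Proof. by []. Qed.
Lemma ropBE (f g : rop) w : (f - g) w = f w - g w. Proof. by []. Qed.
Lemma ropME (f g : rop) w : (f * g) w = g (f w). Proof. by []. Qed.
Lemma ropZE a (f : rop) w : (a *: f) w = a *: f w. Proof. by []. Qed.
Lemma rop1E w : (1 : rop) w = w. Proof. by []. Qed.
Lemma rop_sumE I (r : seq I) (P : pred I) (F : I -> rop) w :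
  (\sum_(i <- r | P i) F i) w = \sum_(i <- r | P i) F i w.
Proof. by elim/big_rec2: _ => [//|i y1 y2 _ <-]. Qed.

End RightOperators.

(* [{poly A}] viewed as an algebra over the scalars of [A]. *)
Definition poly_alg (R : realType) (A : algType R) : Type := {poly A}.

Section PolyAlg.
Context {R : realType} (A : algType R).

HB.instance Definition _ := GRing.NzRing.on (poly_alg A).

Definition poly_alg_scale (a : R) (p : poly_alg A) : poly_alg A :=
  (a%:A)%:P * (p : {poly A}).

Lemma poly_alg_scaleA a b p :
  poly_alg_scale a (poly_alg_scale b p) = poly_alg_scale (a * b) p.
Proof.
by rewrite /poly_alg_scale mulrA -polyCM -scalerAl mul1r scalerA.
Qed.
Lemma poly_alg_scale1 : left_id 1 poly_alg_scale.
Proof. by move=> p; rewrite /poly_alg_scale scale1r mul1r. Qed.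
Lemma poly_alg_scaleDr : right_distributive poly_alg_scale +%R.
Proof. by move=> a p q; rewrite /poly_alg_scale mulrDr. Qed.
Lemma poly_alg_scaleDl p : {morph poly_alg_scale^~ p : a b / a + b}.
Proof. by move=> a b; rewrite /poly_alg_scale scalerDl polyCD mulrDl. Qed.

HB.instance Definition _ := GRing.Zmodule_isLmodule.Build R (poly_alg A)
  poly_alg_scaleA poly_alg_scale1 poly_alg_scaleDr poly_alg_scaleDl.

Lemma poly_alg_scaleAl a (p q : poly_alg A) : a *: (p * q) = a *: p * q.
Proof. exact: mulrA. Qed.
HB.instance Definition _ :=
  GRing.Lmodule_isLalgebra.Build R (poly_alg A) poly_alg_scaleAl.

Lemma poly_alg_scaleAr a (p q : poly_alg A) : a *: (p * q) = p * (a *: q).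
Proof.
change ((a%:A)%:P * ((p : {poly A}) * q) = (p : {poly A}) * ((a%:A)%:P * q)).
rewrite !mulrA; congr (_ * _); apply/polyP => i.
by rewrite coefCM coefMC -scalerAl mul1r -scalerAr mulr1.
Qed.
HB.instance Definition _ :=
  GRing.Lalgebra_isAlgebra.Build R (poly_alg A) poly_alg_scaleAr.

Lemma poly_alg_scaleE a (p : poly_alg A) :
  a *: p = (a%:A)%:P * (p : {poly A}) :> {poly A}.
Proof. by []. Qed.

Lemma coef_poly_algZ a (p : poly_alg A) i :
  (a *: p : {poly A})`_i = a *: (p : {poly A})`_i.
Proof. by rewrite poly_alg_scaleE coefCM -scalerAl mul1r. Qed.

End PolyAlg.

(** * Truncated exponential and logarithm *)

(** With J the top degree, subtracting 2 ^ J times the relation at n from the relation at 2 n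
    cancels the top coefficient and multiplies the j-th one by 2 ^ j - 2 ^ J, which is nonzero. *)
Lemma nat_poly_eq0 (R : realType) (V : lmodType R) (J : nat) (a : nat -> V) :
  (forall n, (0 < n)%N -> \sum_(j < J) (n%:R ^+ j) *: a j = 0) ->
  forall j, (j < J)%N -> a j = 0.
Proof.
elim: J a => [//|J IH] a H.
have H0 j : (j < J)%N -> a j = 0.
  move=> jJ.
  have /(_ j jJ) : forall j, (j < J)%N -> (2 ^+ j - 2 ^+ J) *: a j = 0.
    apply: IH => n n0.
    have := H (2 * n)%N; rewrite muln_gt0 n0 => /(_ isT).
    have /(congr1 (fun v => (2 ^+ J) *: v)) := H n n0.
    rewrite scaler0 !big_ord_recr /= scalerDr => e1 e2.
    have := congr2 (fun x y => x - y) e2 e1.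
    rewrite subr0 natrM exprMn scalerA opprD addrACA subrr addr0.
    rewrite scaler_sumr -sumrB => e; rewrite -[RHS]e; apply: eq_bigr => i _.
    by rewrite !scalerA -scalerBl exprMn; congr (_ *: _); ring.
  move/eqP; rewrite scaler_eq0 subr_eq0 => /orP[/eqP e|/eqP//].
  have : (2 ^ j = 2 ^ J)%N by apply/eqP; rewrite -(eqr_nat R) !natrX e.
  by move/eqP; rewrite eqn_exp2l // => /eqP ej; rewrite ej ltnn in jJ.
move=> j; rewrite ltnS leq_eqVlt => /orP[/eqP->|/H0//].
have := H 1%N isT; rewrite big_ord_recr /= big1 ?add0r => [|i _].
  by rewrite expr1n scale1r.
by rewrite H0 ?scaler0.
Qed.

Section BinomialPolynomial.
Context {R : realType}.

Definition binp (k : nat) : {poly R} :=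
  (k`!%:R)^-1 *: \prod_(i < k) ('X - (i%:R)%:P).

Lemma binpE k n : (binp k).[n%:R] = 'C(n, k)%:R.
Proof.
have k0 : k`!%:R != 0 :> R by rewrite pnatr_eq0 -lt0n fact_gt0.
rewrite /binp hornerZ; apply: (mulfI k0); rewrite mulrA divff // mul1r.
rewrite -natrM mulnC bin_ffact {k0}.
elim: k => [|k IH]; first by rewrite big_ord0 ffactn0 hornerC.
rewrite big_ord_recr /= hornerM IH ffactnSr natrM hornerXsubC.
have [kn|nk] := leqP k n; first by rewrite natrB.
by rewrite ffact_small // !mul0r.
Qed.

Lemma coef0_binp k : (binp k)`_0 = (k == 0)%N%:R.
Proof.
by rewrite -horner_coef0 -[0 in LHS](mulr0n 1) binpE bin0n.
Qed.

Lemma coef1_binp k : (binp k)`_1 = if k == 0%N then 0 else (-1) ^+ k.-1 / k%:R.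
Proof.
case: k => [|k]; first by rewrite /binp big_ord0 coefZ coef1 mulr0.
have k0 j : j`!%:R != 0 :> R by rewrite pnatr_eq0 -lt0n fact_gt0.
suff e : (\prod_(i < k.+1) ('X - (i%:R)%:P) : {poly R})`_1 = (-1) ^+ k * k`!%:R.
  rewrite /binp coefZ e /= factS natrM.
  by rewrite mulrC -mulrA invfM [X in _ * X]mulrCA mulfV ?mulr1.
elim: k => [|k IH].
  by rewrite big_ord_recr big_ord0 /= mul1r subr0 coefX fact0 mulr1 expr0.
rewrite big_ord_recr /= mulrBr coefB coefMX coefMC IH /=.
have -> : (\prod_(i < k.+1) ('X - (i%:R)%:P) : {poly R})`_0 = 0.
  have := coef0_binp k.+1; rewrite coefZ => /eqP.
  by rewrite mulf_eq0 invr_eq0 (negPf (k0 _)) => /eqP.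
by rewrite sub0r factS natrM exprS; ring.
Qed.

End BinomialPolynomial.

Section Newton.
Context {R : realType} (A : algType R).
Implicit Types (P Q : {poly A}) (a : nat -> A) (u g x : A).

Lemma horner_nat P n : P.[n%:R] = \sum_(j < size P) (n%:R ^+ j : R) *: P`_j.
Proof.
rewrite horner_coef; apply: eq_bigr => i _.
by rewrite -natrX -natrX scaler_nat mulr_natr.
Qed.

Lemma poly_nat_inj P Q : (forall n, P.[n%:R] = Q.[n%:R]) -> P = Q.
Proof.
move=> H; apply/eqP; rewrite -subr_eq0; apply/eqP/polyP => i; rewrite coef0.
have [si|] := ltnP i (size (P - Q)); last exact: nth_default.
apply: (nat_poly_eq0 _ si) => n _.
by rewrite -horner_nat hornerD hornerN H subrr.
Qed.

(** Over a noncommutative ring, evaluation is multiplicative at central points such as the natural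
    numbers. *)
Lemma horner_nat_mul P Q n : (P * Q).[n%:R] = P.[n%:R] * Q.[n%:R].
Proof. by apply: hornerM_comm; exact/commr_sym/commr_nat. Qed.

(* The coefficient of degree 1 is the derivative at 0 of the polynomial
   n |-> sum_k 'C(n, k) a_k; for a_k = (g - 1) ^ k this polynomial is
   g ^ n and the coefficient is log g. *)
Definition newton (a : nat -> A) (K : nat) : {poly A} :=
  \sum_(k < K) map_poly (in_alg A) (binp k) * (a k)%:P.

Lemma coef_newton a K i : (newton a K)`_i = \sum_(k < K) (binp k)`_i *: a k.
Proof.
by rewrite coef_sum; apply: eq_bigr => k _; rewrite coefMC coef_map mulr_algl.
Qed.

Lemma newtonE a K n : (newton a K).[n%:R] = \sum_(k < K) 'C(n, k)%:R *: a k.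
Proof.
rewrite horner_sum; apply: eq_bigr => k _.
rewrite horner_nat_mul hornerC -(rmorph_nat (in_alg A)) horner_map binpE.
by rewrite mulr_algl.
Qed.

Lemma coef0_newton a K : (newton a K.+1)`_0 = a 0.
Proof.
rewrite coef_newton big_ord_recl coef0_binp scale1r big1 ?addr0 // => i _.
by rewrite coef0_binp scale0r.
Qed.

Lemma coef1_newton a K :
  (newton a K)`_1 = \sum_(1 <= k < K) ((-1) ^+ k.-1 / k%:R) *: a k.
Proof.
rewrite coef_newton.
rewrite (eq_bigr (fun k : 'I_K => if nat_of_ord k == 0%N then 0 else
   ((-1) ^+ k.-1 / k%:R) *: a k)) => [|k _]; last first.
  by rewrite coef1_binp; case: ifP => //; rewrite scale0r.
rewrite -(big_mkord xpredT (fun k => if k == 0%N then 0 else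
   ((-1) ^+ k.-1 / k%:R) *: a k)).
case: K => [|K]; first by rewrite !big_geq.
rewrite big_ltn // add0r; rewrite !big_nat; apply: eq_bigr => k /andP[k0 _].
by rewrite -if_neg -lt0n k0.
Qed.

(* Truncated series, meaningful only if the argument is nilpotent of order at
   most [K]. *)
Definition nexp K x : A := \sum_(k < K) (k`!%:R)^-1 *: x ^+ k.
Definition nlog K u : A := \sum_(1 <= k < K) ((-1) ^+ k.-1 / k%:R) *: u ^+ k.

Lemma expr_nilp u K n : u ^+ K = 0 -> (K <= n)%N -> u ^+ n = 0.
Proof. by move=> uK Kn; rewrite -(subnK Kn) exprD uK mulr0. Qed.

(** The binomial theorem for ((g - 1) + 1) ^ n: terms beyond [K] vanish by nilpotency, terms beyond
    n because the binomial coefficient does. *)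
Lemma newton_expr g K : (g - 1) ^+ K = 0 ->
  forall n, (newton (fun k => (g - 1) ^+ k) K).[n%:R] = g ^+ n.
Proof.
move=> gK n; rewrite newtonE -[g in RHS](subrK 1) exprD1n.
pose F k := 'C(n, k)%:R *: (g - 1) ^+ k.
rewrite [RHS](eq_bigr (fun k : 'I_n.+1 => F k)); last first.
  by move=> k _; rewrite -scaler_nat.
rewrite -!(big_mkord xpredT F).
have F0 m : (minn K n.+1 <= m)%N -> F m = 0.
  rewrite geq_min => /orP[Km|nm]; first by rewrite /F (expr_nilp gK) ?scaler0.
  by rewrite /F bin_small ?scale0r.
have cut N : (minn K n.+1 <= N)%N ->
    \sum_(0 <= k < N) F k = \sum_(0 <= k < minn K n.+1) F k.
  move=> HN; rewrite (big_cat_nat (leq0n _) HN) //= [X in _ + X]big_nat [X in _ + X]big1 ?addr0 // => k.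
  by case/andP => /F0.
by rewrite !cut // ?geq_minl ?geq_minr.
Qed.

(** First order Taylor expansion at m. The claims are proved together because the second, for
    [P * 'X + c], uses the first for [P] at 0. *)
Lemma comp_poly_shift P m :
  (forall n, (P \Po ('X + m%:R%:P)).[n%:R] = P.[(n + m)%:R]) /\
  (P \Po ('X + m%:R%:P))`_1 = P^`().[m%:R].
Proof.
elim/poly_ind: P => [|P c [IH1 IH2]].
  by rewrite comp_poly0 deriv0 coef0; split => [n|]; rewrite !horner0.
rewrite comp_poly_MXaddC; split => [n|].
  rewrite !hornerD !horner_nat_mul IH1 hornerD !hornerX !hornerC.
  by rewrite -natrD.
rewrite coefD mulrDr coefD coefMX /= coefMC coefC /= addr0 IH2.
rewrite -[in LHS]horner_coef0 -[X in _.[X]](mulr0n 1) IH1 add0n.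
by rewrite derivD derivC addr0 derivM derivX mulr1 hornerD hornerMX addrC.
Qed.

(** The polynomial G with G(n) = g ^ n satisfies G(X + m) = G g ^ m. Its linear coefficients give G'
    = D G with D = log g, and G(0) = 1, so the j-th coefficient of G is D ^ j / j!. Evaluating at 1
    gives g. *)
Lemma nexp_nlog g K : (g - 1) ^+ K = 0 -> nexp K (nlog K (g - 1)) = g.
Proof.
move=> gK.
have [K0|K0] := posnP K.
  move: gK; rewrite K0 expr0 => /eqP; by rewrite oner_eq0.
set D := nlog K _.
pose G := newton (fun k => (g - 1) ^+ k) K.
have GE n : G.[n%:R] = g ^+ n by exact: newton_expr.
have G0 : G`_0 = 1 by rewrite /G -(prednK K0) coef0_newton.
have G1 : G`_1 = D by rewrite /G coef1_newton.
have dG : G^`() = D%:P * G.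
  apply: poly_nat_inj => m; rewrite horner_nat_mul hornerC GE.
  have [E1 <-] := comp_poly_shift G m.
  have -> : G \Po ('X + m%:R%:P) = G * (g ^+ m)%:P.
    apply: poly_nat_inj => n.
    by rewrite E1 horner_nat_mul hornerC !GE exprD.
  by rewrite coefMC G1.
have Gj j : G`_j = (j`!%:R)^-1 *: D ^+ j.
  elim: j => [|j IH]; first by rewrite G0 fact0 invr1 scale1r.
  have /(congr1 (fun p : {poly A} => p`_j)) := dG.
  rewrite coef_deriv coefCM IH -scalerAr -exprS => e.
  have j0 : j.+1%:R != 0 :> R by rewrite pnatr_eq0.
  apply: (scalerI j0); rewrite scaler_nat e scalerA factS natrM invfM mulrA.
  by rewrite divff // mul1r.
have := GE 1%N; rewrite expr1 => <-.
rewrite horner_nat /nexp.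
rewrite (eq_bigr (fun j : 'I__ => G`_j)) => [|j _]; last by rewrite -Gj.
rewrite [RHS](eq_bigr (fun j : 'I__ => G`_j)) => [|j _]; last first.
  by rewrite expr1n scale1r.
rewrite -!(big_mkord xpredT (fun j => G`_j)).
have sG : (size G <= K)%N.
  apply/leq_sizeP => j Kj; rewrite coef_newton big1 // => k _.
  have sb : (size (@binp R k) <= k.+1)%N.
    rewrite (leq_trans (size_scale_leq _ _)) //.
    by rewrite size_prod_XsubC [index_enum _]unlock -enumT size_enum_ord.
  by rewrite nth_default ?scale0r // (leq_trans sb) // (leq_trans _ Kj).
rewrite (big_cat_nat (leq0n _) sG) //= [X in _ + X]big_nat [X in _ + X]big1 ?addr0 // => k /andP[sk _].
by rewrite nth_default.
Qed.

End Newton.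

(** * Dynkin's words *)

Lemma fst_sum (U V : zmodType) I (r : seq I) (P : pred I) (F : I -> U * V) :
  (\sum_(i <- r | P i) F i).1 = \sum_(i <- r | P i) (F i).1.
Proof. by elim/big_rec2: _ => [//|i y1 y2 _ <-]. Qed.

Section DynkinWords.
Context {R : realType} {V : lmodType R} (br : V -> V -> V).
Hypothesis br_linearl : forall a, linear (br^~ a).

Lemma word_op_subproof (n : V -> V) a :
  linear (fun w : V * R^o => (br w.1 a + w.2 *: n a, 0) : V * R^o).
Proof.
move=> k [u r] [v s]; rewrite /= br_linearl /= scalerDl -scalerA.
by congr (_, _); rewrite /= ?scaler0 ?addr0 // scalerDr addrACA.
Qed.

(* The right action of [a] on V + R e, where [e, a] = n a: evaluating a product
   of such operators at e produces left-nested brackets. *)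
Definition word_op (n : V -> V) a : rop V := ROp (word_op_subproof n a).

Lemma word_opE n a w : word_op n a w = (br w.1 a + w.2 *: n a, 0).
Proof. by []. Qed.

Lemma prod_word_op0 n (s : seq V) v :
  (\prod_(a <- s) word_op n a) (v, 0) = (foldl br v s, 0).
Proof.
elim: s v => [|b s IH] v; first by rewrite big_nil.
by rewrite big_cons ropME word_opE /= scale0r addr0 IH.
Qed.

Lemma br0l a : br 0 a = 0.
Proof. by have := br_linearl a (-1) 0 0; rewrite scaler0 add0r scaleN1r addNr. Qed.

Lemma prod_word_op n (s : seq V) v r : s != [::] ->
  (\prod_(a <- s) word_op n a) (v, r) =
  (foldl br v s + r *: left_bracket br (n (head 0 s) :: behead s), 0).
Proof.
case: s => [//|b s] _; rewrite big_cons ropME word_opE prod_word_op0 /=.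
congr (_, _); elim/last_ind: s => [//|s c IH].
by rewrite !foldl_rcons IH addrC br_linearl addrC.
Qed.

Lemma prod_word_op_id (s : seq V) : s != [::] ->
  (\prod_(a <- s) word_op id a) (0, 1) = (left_bracket br s, 0).
Proof.
case: s => [//|b s] s0; rewrite prod_word_op // scale1r.
congr (_, _); rewrite [X in X + _](_ : _ = 0) ?add0r //.
by elim/last_ind: (b :: s) => [//|t c IH]; rewrite foldl_rcons IH br0l.
Qed.

Variables x y : V.

Let tot k l (p q : {ffun 'I_k -> 'I_l.+1}) := (\sum_i (p i + q i))%N.
Let nz k l (p q : {ffun 'I_k -> 'I_l.+1}) := [forall i, 0 < p i + q i]%N.
Let term k l (p q : {ffun 'I_k -> 'I_l.+1}) :=
  (\prod_i ((p i)`! * (q i)`!)%N%:R)^-1 *: left_bracket br (bch_word p q x y).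

Lemma size_bch_word k l (p q : {ffun 'I_k -> 'I_l.+1}) :
  size (bch_word p q x y) = tot p q.
Proof.
rewrite size_flatten /shape -map_comp sumnE big_map big_enum /=.
by apply: eq_bigr => i _; rewrite size_cat !size_nseq.
Qed.

Lemma bch_word_letters k l (p q : {ffun 'I_k -> 'I_l.+1}) :
  all (fun a => (a == x) || (a == y)) (bch_word p q x y).
Proof.
apply/allP => a /flatten_mapP[i _]; rewrite mem_cat.
by case/orP => /nseqP[-> _]; rewrite eqxx ?orbT.
Qed.

(** Exponents summing to [m] are at most [m], so every degree can be indexed with one common bound
    [l]. This is what allows the sums over k and m to be exchanged in [dynkin_words]. *)
Lemma reindex_bch k m l : (m <= l)%N ->
  \sum_(p : {ffun 'I_k -> 'I_m.+1}) \sum_(q | nz p q && (tot p q == m)) term p q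
  = \sum_(p : {ffun 'I_k -> 'I_l.+1}) \sum_(q | nz p q && (tot p q == m)) term p q.
Proof.
move=> ml; rewrite !pair_big_dep /=.
pose wd (p : {ffun 'I_k -> 'I_m.+1}) : {ffun 'I_k -> 'I_l.+1} :=
  [ffun i => inord (p i)].
pose nw (p : {ffun 'I_k -> 'I_l.+1}) : {ffun 'I_k -> 'I_m.+1} :=
  [ffun i => inord (p i)].
have wdE p i : wd p i = p i :> nat.
  by rewrite ffunE inordK // (leq_trans (ltn_ord _)).
have nwE (p : {ffun 'I_k -> 'I_l.+1}) i : (p i <= m)%N -> nw p i = p i :> nat.
  by move=> pm; rewrite ffunE inordK.
rewrite [RHS](reindex_onto (fun pq => (wd pq.1, wd pq.2))
   (fun pq => (nw pq.1, nw pq.2))) => [|[p q] /= /andP[_ /eqP e]]; last first.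
  have le i : (p i + q i <= m)%N.
    by rewrite -e /tot (bigD1 i) //= leq_addr.
  congr (_, _); apply/ffunP => i; apply/val_inj; rewrite /= wdE nwE //.
    exact: leq_trans (leq_addr _ _) (le i).
  exact: leq_trans (leq_addl _ _) (le i).
apply: eq_big => [[p q] /=|[p q] /= _].
  have -> : ((nw (wd p), nw (wd q)) == (p, q)).
    apply/eqP; congr (_, _); apply/ffunP => i; apply/val_inj.
      by rewrite /= nwE wdE // -ltnS.
    by rewrite /= nwE wdE // -ltnS.
  rewrite andbT; congr (_ && _).
    by apply: eq_forallb => i; rewrite !wdE.
  by congr (_ == _); apply: eq_bigr => i _; rewrite !wdE.
rewrite /term; congr (_^-1 *: left_bracket br _).
  by apply: eq_bigr => i _; rewrite !wdE.
by congr flatten; apply: eq_map => i; rewrite !wdE.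
Qed.

Let X := word_op id x.
Let Y := word_op id y.
Let ev (f : rop V) : V := (f (0, 1)).1.

(** Each of the [k] factors contributes a pair of exponents other than (0, 0), and evaluation at e
    turns the resulting word of operators into a bracket. Since [0 < k], that word is nonempty. *)
Lemma ev_pow k l : (0 < k)%N ->
  ev ((nexp l.+1 X * nexp l.+1 Y - 1) ^+ k) =
  \sum_(p : {ffun 'I_k -> 'I_l.+1}) \sum_(q | nz p q) term p q.
Proof.
move=> k0.
pose F (ij : 'I_l.+1 * 'I_l.+1) : rop V :=
  ((ij.1`! * ij.2`!)%N%:R)^-1 *: (X ^+ ij.1 * Y ^+ ij.2).
pose Q := [pred ij : 'I_l.+1 * 'I_l.+1 | 0 < ij.1 + ij.2]%N.
have -> : nexp l.+1 X * nexp l.+1 Y - 1 = \sum_(ij | Q ij) F ij.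
  rewrite /nexp big_distrlr /=.
  rewrite pair_big /= (bigD1 (ord0, ord0)) //= fact0 invr1 !scale1r !expr0 mulr1.
  rewrite addrAC subrr add0r; apply: eq_big => [[i j]|[i j] _] /=.
    by rewrite addn_gt0 !lt0n -negb_and xpair_eqE -!val_eqE.
  by rewrite /F /= -scalerAl -scalerAr scalerA natrM invfM.
have -> : (\sum_(ij | Q ij) F ij) ^+ k = \prod_(i < k) \sum_(ij | Q ij) F ij.
  by rewrite prodr_const card_ord.
rewrite bigA_distr_big /ev rop_sumE.
rewrite fst_sum.
rewrite pair_big_dep /=.
pose h (pq : {ffun 'I_k -> 'I_l.+1} * {ffun 'I_k -> 'I_l.+1}) :
  {ffun 'I_k -> 'I_l.+1 * 'I_l.+1} := [ffun i => (pq.1 i, pq.2 i)].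
pose h' (f : {ffun 'I_k -> 'I_l.+1 * 'I_l.+1}) :
  {ffun 'I_k -> 'I_l.+1} * {ffun 'I_k -> 'I_l.+1} :=
  ([ffun i => (f i).1], [ffun i => (f i).2]).
have hb : bijective h.
  exists h' => [[p q]|f].
    by congr (_, _); apply/ffunP => i; rewrite !ffunE.
  by apply/ffunP => i; rewrite !ffunE -surjective_pairing.
rewrite (reindex h) /=; last exact: onW_bij.
apply: eq_big => [[p q] /=|[p q] /=].
  apply/ffun_onP/forallP => H i; have := H i; rewrite !ffunE //.
move=> /ffun_onP nzpq.
rewrite (eq_bigr (fun i => ((p i)`! * (q i)`!)%N%:R^-1 *: (X ^+ p i * Y ^+ q i)));
  last by move=> i _; rewrite /F ffunE.
rewrite scaler_prod ropZE /= prodfV /term; congr (_ *: _).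
have -> : \prod_(i < k) (X ^+ p i * Y ^+ q i) =
    \prod_(a <- bch_word p q x y) word_op id a.
  rewrite big_flatten big_map [index_enum _]unlock -enumT; apply: eq_bigr => i _.
  by rewrite big_cat !big_nseq !iter_mulr_1.
rewrite prod_word_op_id // -size_eq0 size_bch_word -lt0n /tot.
have := nzpq (Ordinal k0); rewrite ffunE inE /= => H.
by rewrite (bigD1 (Ordinal k0)) //= ltn_addr.
Qed.

(** The logarithm of the product of the exponentials of the operators of x and y, evaluated at e and
    sorted by degree. The factor [m%:R] compensates the 1/m in [bch_term]. *)
Lemma dynkin_words K l :
  (forall s, all (fun a => (a == x) || (a == y)) s -> (K <= size s)%N ->
    left_bracket br s = 0) -> (K <= l.+1)%N ->
  \sum_(1 <= k < l.+1) ((-1) ^+ k.-1 / k%:R) *: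
     ev ((nexp l.+1 X * nexp l.+1 Y - 1) ^+ k)
  = \sum_(1 <= m < K) m%:R *: bch_term br m x y.
Proof.
move=> nil Kl.
pose S k m := \sum_(p : {ffun 'I_k -> 'I_l.+1})
  \sum_(q | nz p q && (tot p q == m)) term p q.
transitivity (\sum_(1 <= k < l.+1) \sum_(1 <= m < K)
    ((-1) ^+ k.-1 / k%:R) *: S k m).
  rewrite !big_nat; apply: eq_bigr => k /andP[k0 _].
  rewrite ev_pow // -scaler_sumr; congr (_ *: _).
  rewrite exchange_big /=; apply: eq_bigr => p _.
  under [RHS]eq_bigr do rewrite big_mkcondr.
  rewrite [RHS]exchange_big /=; apply: eq_bigr => q nzq.
  have tot0 : (0 < tot p q)%N.
    rewrite /tot (bigD1 (Ordinal k0)) //= ltn_addr //.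
    by move/forallP: nzq.
  have [tK|Kt] := ltnP (tot p q) K; last first.
    by rewrite /term nil ?bch_word_letters ?size_bch_word // scaler0 big1 // => m;
       rewrite if_same.
  rewrite (bigD1_seq (tot p q)) ?mem_index_iota ?tot0 ?iota_uniq //= eqxx.
  by rewrite big1 ?addr0 // => m; rewrite eq_sym => /negPf ->.
rewrite exchange_big /= !big_nat; apply: eq_bigr => m /andP[m0 mK].
rewrite /bch_term scalerA divff ?scale1r ?pnatr_eq0 -?lt0n //.
have ml : (m <= l)%N by rewrite -ltnS (leq_trans mK).
(* Each of the k factors has at least one letter, so degree m involves only k <= m. *)
rewrite (big_cat_nat (n := m.+1)) //= [X in _ + X]big_nat [X in _ + X]big1.
  rewrite addr0; apply: eq_bigr => k _; congr (_ *: _).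
  by rewrite /S -reindex_bch.
move=> k /andP[mk _]; rewrite /S big1 ?scaler0 // => p _; rewrite big1 // => q.
case/andP => /forallP H /eqP e; suff : (k <= m)%N by rewrite leqNgt mk.
rewrite -e /tot -[X in (X <= _)%N]card_ord -sum1_card.
by apply: leq_sum => i _; exact: H.
Qed.

End DynkinWords.

(** * The Dynkin series in an associative algebra *)

Lemma sum_triangle (V : nmodType) (L : nat) (F : nat -> nat -> V) :
  (forall a b, (L <= a + b)%N -> F a b = 0) ->
  \sum_(n < L) \sum_(i < n.+1) F (n - i)%N i = \sum_(a < L) \sum_(b < L) F a b.
Proof.
move=> F0; rewrite [RHS]exchange_big /=.
transitivity (\sum_(n < L) \sum_(i < L | (i <= n)%N) F (n - i)%N i).
  apply: eq_bigr => n _.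
  by rewrite (big_ord_widen_cond L predT (fun i => F (n - i)%N i)) //.
rewrite (exchange_big_dep predT) //=; apply: eq_bigr => b _.
have bL : (b <= L)%N by rewrite ltnW.
rewrite -(big_mkord (fun n => b <= n)%N (fun n => F (n - b)%N b)).
rewrite (big_cat_nat (leq0n _) bL) /= big_nat_cond big1 ?add0r => [|i]; last first.
  by case/andP => /andP[_ ib] bi; rewrite ltnNge bi in ib.
rewrite -{1}[nat_of_ord b]add0n big_addn.
rewrite (eq_bigl predT) => [|i]; last by rewrite leq_addl.
under eq_bigr do rewrite addnK.
rewrite -(big_mkord predT (fun a => F a b)) [RHS](big_cat_nat (leq0n _) (leq_subr b L)).
rewrite /= [X in _ = _ + X]big_nat [X in _ = _ + X]big1 ?addr0 // => i /andP[Lb _].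
by rewrite F0 // addnC -leq_subLR.
Qed.

Section BchMorphism.
Context {R : realType} {V V' : lmodType R}.
Variables (br : V -> V -> V) (br' : V' -> V' -> V').

Lemma bch_word_map k m (p q : {ffun 'I_k -> 'I_m.+1}) (phi : V -> V') x y :
  bch_word p q (phi x) (phi y) = map phi (bch_word p q x y).
Proof.
rewrite /bch_word map_flatten -map_comp; congr flatten; apply: eq_map => i /=.
by rewrite map_cat !map_nseq.
Qed.

(** Two maps are allowed because they differ in [bch_term_monom]: there a letter acquires degree 1
    and a bracket of m letters degree m. *)
Lemma bch_term_morph m (phi : {linear V -> V'}) (psi : V -> V') x y :
  (forall s, size s = m -> all (fun a => (a == x) || (a == y)) s ->
     phi (left_bracket br s) = left_bracket br' (map psi s)) ->
  bch_term br' m (psi x) (psi y) = phi (bch_term br m x y).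
Proof.
move=> H; rewrite /bch_term linearZ /=; congr (_ *: _).
rewrite linear_sum; apply: eq_bigr => k _; rewrite linearZ /=; congr (_ *: _).
rewrite linear_sum; apply: eq_bigr => p _.
rewrite linear_sum; apply: eq_bigr => q /andP[_ /eqP e].
rewrite linearZ /=; congr (_ *: _); rewrite bch_word_map H //.
  by rewrite size_bch_word.
exact: bch_word_letters.
Qed.

End BchMorphism.

(* The word in the formal letters [x = 1] and [y = 0]. *)
Lemma bch_word_shape (R : realType) (V : lmodType R) k m
    (p q : {ffun 'I_k -> 'I_m.+1}) (x y : V) :
  bch_word p q x y =
  [seq (if c == 1 then x else y) | c : R^o <- bch_word p q (1 : R^o) 0].
Proof. by rewrite -bch_word_map eqxx eq_sym oner_eq0. Qed.

(** Words of one letter do not involve the bracket, so it can be replaced by the zero bracket, for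
    which [dynkin_words] with [K = 2] and [l = 1] is this identity. *)
Lemma bch_term1 (R : realType) (V : lmodType R) (br : V -> V -> V) x y :
  bch_term br 1%N x y = x + y.
Proof.
pose br0 (_ _ : V) : V := 0.
have lin0 a : linear (br0^~ a) by move=> k u v; rewrite /br0 scaler0 addr0.
transitivity (bch_term br0 1%N x y).
  by apply: (@bch_term_morph _ _ _ br0 br 1%N idfun id) => -[|a []].
have := @dynkin_words _ _ br0 lin0 x y 2 1.
rewrite !big_nat1 !scale1r expr1 invr1 mulr1 scale1r => <- //.
  rewrite /nexp !big_ord_recl !big_ord0 /= !fact0 !addr0 invr1 /br0.
  by rewrite !scaler0 !scale1r !addr0 !add0r subr0 scale1r.
case=> [|a [|b s]] // _ _.
by rewrite /left_bracket /=; elim: s a b => [//|c s IH] a b; exact: (IH (br0 a b) c).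
Qed.

Section AlgebraBch.
Context {R : realType} (A : algType R).
Implicit Types u v X Y : A.

Definition comm u v : A := u * v - v * u.

Lemma comm_linearl a : linear (comm^~ a).
Proof.
move=> k u v; rewrite /comm mulrDl mulrDr -scalerAl -scalerAr scalerBr.
by rewrite addrACA -opprD.
Qed.

(** Joint nilpotency: nilpotency of [X] and of [Y] separately would not make exp X exp Y - 1
    nilpotent. *)
Definition nil_words X Y K := forall s : seq A,
  all (fun a => (a == X) || (a == Y)) s -> (K <= size s)%N ->
  \prod_(a <- s) a = 0.

Lemma nil_words_l X Y K n : nil_words X Y K -> (K <= n)%N -> X ^+ n = 0.
Proof.
move=> H Kn; have := H (nseq n X); rewrite size_nseq big_nseq iter_mulr_1.
by apply => //; rewrite all_nseq eqxx orbT.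
Qed.

Lemma nil_words_r X Y K n : nil_words X Y K -> (K <= n)%N -> Y ^+ n = 0.
Proof.
move=> H Kn; have := H (nseq n Y); rewrite size_nseq big_nseq iter_mulr_1.
by apply => //; rewrite all_nseq eqxx !orbT.
Qed.

Lemma nil_nexp X Y K l : nil_words X Y K ->
  (nexp l.+1 X * nexp l.+1 Y - 1) ^+ K = 0.
Proof.
move=> H.
(* [P n u] says that [u] behaves like a combination of words of at least n letters. *)
pose P n u := forall s, all (fun a => (a == X) || (a == Y)) s ->
  (K <= n + size s)%N -> u * \prod_(a <- s) a = 0.
suff /(_ K) PK : forall n, P n ((nexp l.+1 X * nexp l.+1 Y - 1) ^+ n).
  by have := PK [::] isT; rewrite big_nil mulr1 addn0; exact.
elim=> [|n IH] s ss Ks; first by rewrite expr0 mul1r H.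
set W := nexp _ _ * _ - 1 in IH *.
have WE : W = \sum_(ij : 'I_l.+1 * 'I_l.+1 | ij != (ord0, ord0))
    (ij.1`!%:R^-1 *: X ^+ ij.1 * (ij.2`!%:R^-1 *: Y ^+ ij.2)).
  rewrite /W /nexp big_distrlr /=.
  rewrite pair_big /= (bigD1 (ord0, ord0)) //= fact0 invr1 !scale1r !expr0 mulr1.
  by rewrite addrAC subrr add0r.
rewrite exprSr -mulrA {2}WE mulr_suml mulr_sumr big1 // => -[i j] /= ij0.
rewrite -scalerAr -!scalerAl -!scalerAr scalerA.
suff -> : W ^+ n * (X ^+ i * Y ^+ j * \prod_(a <- s) a) = 0 by rewrite scaler0.
have -> : X ^+ i * Y ^+ j * \prod_(a <- s) a =
    \prod_(a <- nseq i X ++ nseq j Y ++ s) a.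
  by rewrite !big_cat /= !big_nseq !iter_mulr_1 mulrA.
apply: IH; first by rewrite !all_cat ss !all_nseq !eqxx !orbT.
rewrite !size_cat !size_nseq (leq_trans Ks) // addSnnS leq_add2l addnA.
rewrite -add1n leq_add2r addn_gt0 !lt0n -negb_and; move: ij0.
by rewrite xpair_eqE -!val_eqE.
Qed.

Definition ad X : rop A := word_op comm_linearl id X.

Lemma ad_pow X n u : (ad X ^+ n) (u, 0) = (iter n (comm^~ X) u, 0).
Proof.
elim: n => [|n IH]; first by rewrite expr0.
by rewrite exprSr ropME IH /= scale0r addr0.
Qed.

Lemma mulr_exprn_comm u X n :
  u * X ^+ n = \sum_(i < n.+1) 'C(n, i)%:R *: (X ^+ (n - i) * iter i (comm^~ X) u).
Proof.
elim: n => [|n IH].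
  by rewrite big_ord1 bin0 scale1r expr0 mul1r mulr1.
pose F j := iter j (comm^~ X) u.
have FS j : F j * X = X * F j + F j.+1 by rewrite /= /comm addrC subrK.
rewrite exprSr mulrA IH mulr_suml.
under eq_bigr do rewrite -scalerAl -mulrA FS mulrDr mulrA -exprSr scalerDr.
rewrite big_split /=.
rewrite [RHS]big_ord_recl /= bin0 scale1r subn0.
under [X in _ = _ + X]eq_bigr do
  rewrite /bump /= add1n binS natrD scalerDl subSS.
rewrite [X in _ = _ + X]big_split /= addrA; congr (_ + _).
rewrite [LHS]big_ord_recl /= bin0 scale1r subn0; congr (_ + _).
rewrite [RHS]big_ord_recr /= bin_small // scale0r addr0.
by apply: eq_bigr => i _; rewrite /bump /= add1n subnSK.
Qed.

(* exp (- X) u exp X, by [mul_nexp]. *)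
Definition conj_exp l X u : A := ((nexp l.+1 (ad X)) (u, 0)).1.

Lemma nexp_ad l X u : (nexp l.+1 (ad X)) (u, 0) = (conj_exp l X u, 0).
Proof.
rewrite [LHS]surjective_pairing; congr (_, _).
rewrite rop_sumE; elim/big_rec: _ => // i w _; rewrite ropZE ad_pow /= => ->.
by rewrite scaler0 addr0.
Qed.

Lemma conj_expE l X u :
  conj_exp l X u = \sum_(i < l.+1) (i`!%:R)^-1 *: iter i (comm^~ X) u.
Proof.
rewrite /conj_exp rop_sumE fst_sum; apply: eq_bigr => i _.
by rewrite ropZE ad_pow.
Qed.

(** Only the shape matters: the n factors [X] are distributed over the two sides of [u], so one side
    receives at least half of them. *)
Lemma iter_comm_mul X u n : exists c : nat -> R, iter n (comm^~ X) u =
  \sum_(i < n.+1) c i *: (X ^+ i * u * X ^+ (n - i)).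
Proof.
elim: n => [|n [c IH]].
  by exists (fun=> 1); rewrite big_ord1 scale1r mul1r mulr1.
exists (fun i => (if (i <= n)%N then c i else 0) - (if i is j.+1 then c j else 0)).
under eq_bigr do rewrite scalerBl.
rewrite sumrB big_ord_recr /= ltnn scale0r addr0 [X in _ - X]big_ord_recl scale0r.
rewrite add0r IH /comm mulr_suml mulr_sumr; congr (_ - _).
  apply: eq_bigr => i _; have iln : (i <= n)%N by rewrite -ltnS.
  by rewrite iln -scalerAl subSn // exprSr !mulrA.
apply: eq_bigr => i _; rewrite -scalerAr !mulrA -exprS /bump /= ?add1n ?subSS.
by rewrite add0n /bump add1n.
Qed.

Lemma iter_comm_nil X u K n : X ^+ K = 0 -> (2 * K <= n)%N ->
  iter n (comm^~ X) u = 0.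
Proof.
move=> XK Kn; have [c ->] := iter_comm_mul X u n.
rewrite big1 // => i _; have [Ki|iK] := leqP K i.
  by rewrite (expr_nilp XK) // !mul0r scaler0.
by rewrite (expr_nilp XK (n := n - i)) ?mulr0 ?scaler0 //; lia.
Qed.

(** The bound 3 K makes the truncated Cauchy product exact: if a + b > l, then a >= K and X ^ a = 0,
    or b >= 2 K and the b-fold commutator vanishes. *)
Lemma mul_nexp X u K l : X ^+ K = 0 -> (3 * K <= l.+1)%N ->
  u * nexp l.+1 X = nexp l.+1 X * conj_exp l X u.
Proof.
move=> XK Kl; rewrite conj_expE /nexp big_distrlr /=.
pose F a b := a`!%:R^-1 *: X ^+ a * (b`!%:R^-1 *: iter b (comm^~ X) u).
rewrite -(sum_triangle (F := F)) => [|a b Lab]; last first.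
  rewrite /F; have [Ka|aK] := leqP K a.
    by rewrite (expr_nilp XK) // scaler0 mul0r.
  by rewrite (iter_comm_nil _ XK) ?scaler0 ?mulr0 //; lia.
rewrite mulr_sumr; apply: eq_bigr => n _; rewrite -scalerAr mulr_exprn_comm.
rewrite scaler_sumr; apply: eq_bigr => i _.
rewrite /F -scalerAl -scalerAr !scalerA; congr (_ *: _).
have i_n : (i <= n)%N by rewrite -ltnS.
have f0 k : k`!%:R != 0 :> R by rewrite pnatr_eq0 -lt0n fact_gt0.
by rewrite -(bin_fact i_n) !natrM; field; rewrite !f0 pnatr_eq0 -lt0n bin_gt0 i_n.
Qed.

Section Derivation.
Variables (delta : A -> A).
Hypothesis delta_linear : linear delta.
Hypothesis delta_mul : forall u v, delta (u * v) = delta u * v + u * delta v.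

Lemma derivationD u v : delta (u + v) = delta u + delta v.
Proof. by rewrite -[u in LHS]scale1r delta_linear scale1r. Qed.

Lemma derivation0 : delta 0 = 0.
Proof. by have := delta_linear (-1) 0 0; rewrite !scaleN1r oppr0 addr0 addNr. Qed.

Lemma derivationZ k u : delta (k *: u) = k *: delta u.
Proof. by rewrite -[k *: u]addr0 delta_linear derivation0 addr0. Qed.

Lemma derivation_sum I (r : seq I) (P : pred I) (F : I -> A) :
  delta (\sum_(i <- r | P i) F i) = \sum_(i <- r | P i) delta (F i).
Proof. by apply: (big_morph delta derivationD derivation0). Qed.

Lemma derivation1 : delta 1 = 0.
Proof.
have := delta_mul 1 1; rewrite !mul1r mulr1 => /esym/eqP.
by rewrite -subr_eq0 addrK => /eqP.
Qed.

Lemma derivation_nexp X K l : delta X = X -> X ^+ K = 0 -> (K <= l)%N ->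
  delta (nexp l.+1 X) = nexp l.+1 X * X.
Proof.
move=> dX XK Kl.
have dn n : delta (X ^+ n) = n%:R *: X ^+ n.
  elim: n => [|n IH]; first by rewrite expr0 derivation1 scale0r.
  rewrite exprSr delta_mul IH dX -scalerAl -exprSr -[X ^+ n.+1 in X in _ + X]scale1r.
  by rewrite -scalerDl natr1.
rewrite derivation_sum /nexp mulr_suml.
rewrite big_ord_recl derivationZ dn scale0r scaler0 add0r.
rewrite [RHS]big_ord_recr /= (expr_nilp XK Kl) scaler0 mul0r addr0.
apply: eq_bigr => i _; rewrite derivationZ dn scalerA /bump /= add1n.
rewrite -scalerAl -exprSr factS natrM invfM mulrAC mulVf ?mul1r //.

Qed.

End Derivation.

Lemma foldl_comm_nil X Y K u s : nil_words X Y K ->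
  all (fun a => (a == X) || (a == Y)) s -> (2 * K <= size s)%N ->
  foldl comm u s = 0.
Proof.
move=> nilXY ss Ks.
(* [Q n w] says that [w] behaves like a combination of words with one middle factor and n letters
   around it. Among 2 K letters in all, [K] are on the same side. *)
pose Q n w := forall s1 s2, all (fun a => (a == X) || (a == Y)) s1 ->
  all (fun a => (a == X) || (a == Y)) s2 -> (2 * K <= n + size s1 + size s2)%N ->
  \prod_(a <- s1) a * w * \prod_(a <- s2) a = 0.
suff Qs n w t : all (fun a => (a == X) || (a == Y)) t -> Q n w ->
    Q (n + size t)%N (foldl comm w t).
  have /(Qs _ _ s ss) : Q 0%N u.
    move=> s1 s2 a1 a2; rewrite add0n => h.
    have [h1|h1] := leqP K (size s1); first by rewrite nilXY // !mul0r.
    rewrite (nilXY s2) ?mulr0 //; move: (size s1) (size s2) h h1; clear; lia.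
  move=> /(_ [::] [::] isT isT); rewrite !big_nil mul1r mulr1; apply.
  by rewrite !addn0.
elim: t n w => [|b t IH] n w /=; first by rewrite addn0.
move=> /andP[bXY tXY] Qw; rewrite addnS -addSn; apply: IH => //.
move=> s1 s2 a1 a2 h; rewrite /comm mulrBr mulrBl.
have := Qw s1 (b :: s2) a1; rewrite /= bXY a2 big_cons => /(_ isT).
have := Qw (rcons s1 b) s2; rewrite all_rcons bXY a1 -cats1 big_cat big_seq1.
move=> /(_ isT a2) /=; rewrite size_cat /= !mulrA => ->; last by
  move: (size s1) (size s2) h; clear; lia.
by move=> ->; [rewrite subrr | move: (size s1) (size s2) h; clear; lia].
Qed.

Lemma left_bracket_comm_nil X Y K s : nil_words X Y K ->
  all (fun a => (a == X) || (a == Y)) s -> ((2 * K).+1 <= size s)%N ->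
  left_bracket comm s = 0.
Proof.
by case: s => //= a s nilXY /andP[_ ss] Ks; exact: foldl_comm_nil nilXY _ _.
Qed.

End AlgebraBch.

Lemma nil_words_ad (R : realType) (A : algType R) (X Y : A) K :
  nil_words X Y K -> nil_words (ad X) (ad Y) (2 * K).+1.
Proof.
move=> nilXY s ss Ks.
have [t [st tt]] : exists t, s = map (@ad R A) t /\
    all (fun a => (a == X) || (a == Y)) t.
  elim: s ss {Ks} => [|a s IH] /=; first by exists [::].
  case/andP => aXY /IH[t [-> tt]]; case/orP: aXY => /eqP ->.
    by exists (X :: t); rewrite /= eqxx.
  by exists (Y :: t); rewrite /= eqxx orbT.
rewrite st big_map; apply: rop_ext => -[v r].
rewrite st size_map in Ks.
rewrite prod_word_op -?size_eq0 -?lt0n ?(leq_ltn_trans _ Ks) //.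
rewrite (foldl_comm_nil _ nilXY tt) ?(ltnW Ks) // add0r.
have -> : id (head 0 t) :: behead t = t by case: t Ks {st tt}.
by rewrite (left_bracket_comm_nil nilXY) // scaler0.
Qed.

Section DerivationLog.
Context {R : realType} (A : algType R).
Variables (delta : A -> A).
Hypothesis delta_linear : linear delta.
Hypothesis delta_mul : forall u v, delta (u * v) = delta u * v + u * delta v.

(** [Gam] maps u + e to g^-1 u g + c + e, where delta g = g c; hence delta (g ^ n) = g ^ n s_n with
    (s_n, 1) the image of e under Gam ^ n. As polynomials in n this reads P = G S with G(0) = 1 and
    S(0) = 0. The linear coefficients then say that delta (log g) is the component in [A] of log Gam
    at e, which [dynkin_words] computes. *)
Lemma derivation_nlog X Y K l : delta X = X -> delta Y = Y ->
  nil_words X Y K -> (4 * K + 4 <= l)%N ->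
  delta (nlog l.+1 (nexp l.+1 X * nexp l.+1 Y - 1)) =
  \sum_(1 <= m < (2 * K).+1) m%:R *: bch_term (@comm R A) m X Y.
Proof.
move=> dX dY nilXY Kl.
set g := nexp l.+1 X * nexp l.+1 Y.
pose Gam := nexp l.+1 (ad X) * nexp l.+1 (ad Y).
have XK : X ^+ K = 0 by exact: nil_words_l nilXY (leqnn _).
have YK : Y ^+ K = 0 by exact: nil_words_r nilXY (leqnn _).
pose c := conj_exp l Y X + Y.
have Gam0 u : Gam (u, 0) = (conj_exp l Y (conj_exp l X u), 0).
  by rewrite ropME !nexp_ad.
(* As [Z, Z] = 0, the exponential series at e stops after its linear term. *)
have nexp1 Z : (nexp l.+1 (ad Z)) (0, 1) = (Z, 1).
  case: l Kl {g Gam c Gam0} => [|l] Kl; first by move: Kl; clear; lia.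
  have adZ : (ad Z) (0, 1) = (Z, 0).
    by rewrite word_opE /= /comm mul0r mulr0 subr0 add0r scale1r.
  have adn i : (ad Z ^+ i.+2) (0, 1) = 0.
    rewrite 2!exprS !ropME adZ word_opE /= /comm subrr scale0r addr0 ad_pow.
    by congr (_, _); elim: i => //= i ->; rewrite /comm mul0r mulr0 subr0.
  rewrite rop_sumE 2!big_ord_recl big1 => [|i _]; last first.
    by rewrite ropZE adn scaler0.
  rewrite !ropZE expr0 expr1 rop1E adZ !fact0 invr1 !scale1r addr0.
  by congr (_, _); rewrite /= ?add0r ?addr0.
have Gam1 : Gam (0, 1) = (c, 1).
  rewrite ropME nexp1; have -> : (X, 1) = (X, 0) + (0, 1) :> A * R^o.
    by congr (_, _); rewrite ?addr0 ?add0r.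
  have := rop_linear (nexp l.+1 (ad Y)) 1 (X, 0) (0, 1); rewrite !scale1r => ->.
  by rewrite nexp_ad nexp1; congr (_, _); rewrite /= add0r.
have mulg u : u * g = g * conj_exp l Y (conj_exp l X u).
  rewrite /g mulrA (mul_nexp u XK) ?mulrA; last by lia.
  by rewrite -!mulrA; congr (_ * _); rewrite (mul_nexp _ YK) //; lia.
have dg : delta g = g * c.
  rewrite /g delta_mul !(derivation_nexp delta_linear delta_mul _ XK) //; last by lia.
  rewrite (derivation_nexp delta_linear delta_mul _ YK) //; last by lia.
  rewrite -mulrA (mul_nexp _ YK); last by lia.
  by rewrite !mulrA -mulrDr.
pose sn n := ((Gam ^+ n) (0, 1)).1.
have snE n : (Gam ^+ n) (0, 1) = (sn n, 1).
  rewrite [LHS]surjective_pairing; congr (_, _).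
  elim: n => [|n IH]; first by rewrite expr0.
  rewrite exprSr ropME; set w := (Gam ^+ n) (0, 1) in IH *.
  rewrite [w]surjective_pairing IH; have -> : (w.1, 1) = (w.1, 0) + (0, 1) :> A * R^o.
    by congr (_, _); rewrite ?addr0 ?add0r.
  have := rop_linear Gam 1 (w.1, 0) (0, 1); rewrite !scale1r => ->.
  by rewrite Gam0 Gam1 /= add0r.
have snS n : sn n.+1 = conj_exp l Y (conj_exp l X (sn n)) + c.
  rewrite /sn exprSr ropME snE.
  have -> : (sn n, 1) = (sn n, 0) + (0, 1) :> A * R^o.
    by congr (_, _); rewrite ?addr0 ?add0r.
  have := rop_linear Gam 1 (sn n, 0) (0, 1); rewrite !scale1r => ->.
  by rewrite Gam0 Gam1 /= addr0.
have dgn n : delta (g ^+ n) = g ^+ n * sn n.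
  elim: n => [|n IH].
    by rewrite expr0 (derivation1 delta_mul) /sn expr0 /= mulr0.
  rewrite {1}exprSr delta_mul IH dg snS [RHS]mulrDr; congr (_ + _).
    by rewrite -mulrA mulg exprSr -mulrA.
  by rewrite exprSr -mulrA.
have gL : (g - 1) ^+ l.+1 = 0.
  by rewrite (expr_nilp (nil_nexp l nilXY)) //; lia.
have GL : (Gam - 1) ^+ l.+1 = 0.
  by rewrite (expr_nilp (nil_nexp l (nil_words_ad nilXY))) //; lia.
pose P := newton (fun k => delta ((g - 1) ^+ k)) l.+1.
pose G := newton (fun k => (g - 1) ^+ k) l.+1.
pose S := newton (fun k => (((Gam - 1) ^+ k) (0, 1)).1) l.+1.
have PE : P = G * S.
  apply: poly_nat_inj => n; rewrite horner_nat_mul newton_expr // !newtonE.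
  transitivity (delta (g ^+ n)).
    rewrite -(newton_expr gL) newtonE (derivation_sum delta_linear).
    by apply: eq_bigr => i _; rewrite (derivationZ delta_linear).
  rewrite dgn; congr (_ * _).
  rewrite /sn -(newton_expr GL) newtonE rop_sumE fst_sum.
  by apply: eq_bigr => i _; rewrite ropZE.
have := congr1 (fun p : {poly A} => p`_1) PE.
rewrite coefM big_ord_recl big_ord1 /= subn0 subnn !coef1_newton !coef0_newton.
rewrite expr0 mul1r rop1E mulr0 addr0 => e.
rewrite /nlog (derivation_sum delta_linear).
rewrite (eq_bigr _ (fun k _ => derivationZ delta_linear _ _)).
rewrite e.
apply: (@dynkin_words R A (@comm R A) (@comm_linearl R A) X Y (2 * K).+1 l).
  move=> s ss Ks; exact: left_bracket_comm_nil nilXY ss Ks.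
by lia.
Qed.

End DerivationLog.

Section DynkinAlgebra.
Context {R : realType} (A : algType R).
Implicit Types (p q : poly_alg A) (X Y : A).

(* The derivation t d/dt, which fixes the monomials of degree 1. *)
Definition euler p : poly_alg A := ('X : {poly A}) * (p : {poly A})^`().

Lemma coef_euler p i : (euler p : {poly A})`_i = i%:R *: (p : {poly A})`_i.
Proof.
rewrite /euler coefXM; case: i => [|i]; first by rewrite scale0r.
by rewrite coef_deriv /= scaler_nat.
Qed.

Lemma euler_linear : linear euler.
Proof.
move=> a p q; apply/polyP => i.
rewrite coefD coef_poly_algZ !coef_euler coefD coef_poly_algZ.
by rewrite scalerDr !scalerA mulrC.
Qed.

Lemma euler_mul p q : euler (p * q) = euler p * q + p * euler q.
Proof.
rewrite /euler; change (('X : {poly A}) * ((p : {poly A}) * (q : {poly A}))^`() =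
  'X * (p : {poly A})^`() * (q : {poly A}) + (p : {poly A}) * ('X * (q : {poly A})^`())).
rewrite derivM mulrDr !mulrA; congr (_ + _ * _).
exact/commr_sym/commr_polyX.
Qed.

Lemma horner_mul01 (c : A) (p q : {poly A}) : c = 0 \/ c = 1 ->
  (p * q).[c] = p.[c] * q.[c].
Proof.
by move=> [->|->]; apply: hornerM_comm; rewrite /comm_poly ?mulr0 ?mul0r ?mulr1 ?mul1r.
Qed.

Lemma horner_exp01 (c : A) p k : c = 0 \/ c = 1 ->
  (p ^+ k : {poly A}).[c] = (p : {poly A}).[c] ^+ k.
Proof.
move=> c01; elim: k => [|k IH]; first by rewrite !expr0 hornerC.
by rewrite !exprS horner_mul01 // IH.
Qed.

Lemma horner_poly_algZ (c : A) a p : c = 0 \/ c = 1 ->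
  (a *: p : {poly A}).[c] = a *: (p : {poly A}).[c].
Proof.
by move=> c01; rewrite poly_alg_scaleE horner_mul01 // hornerC -scalerAl mul1r.
Qed.

Lemma horner_nexp01 (c : A) K p : c = 0 \/ c = 1 ->
  (nexp K p : {poly A}).[c] = nexp K ((p : {poly A}).[c]).
Proof.
move=> c01; rewrite /nexp horner_sum; apply: eq_bigr => k _.
by rewrite horner_poly_algZ // horner_exp01.
Qed.

Lemma horner_nlog01 (c : A) K p : c = 0 \/ c = 1 ->
  (nlog K p : {poly A}).[c] = nlog K ((p : {poly A}).[c]).
Proof.
move=> c01; rewrite /nlog horner_sum; apply: eq_bigr => k _.
by rewrite horner_poly_algZ // horner_exp01.
Qed.

Lemma mul_monomials (a b : A) m n :
  (a%:P * 'X^m) * (b%:P * 'X^n) = (a * b)%:P * 'X^(m + n) :> {poly A}.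
Proof.
rewrite polyCM exprD !mulrA; congr (_ * _); rewrite -!mulrA; congr (_ * _).
exact/commr_sym/commr_polyXn.
Qed.

Definition monom X : poly_alg A := (X%:P : {poly A}) * 'X^1.

Lemma monom_prod (s : seq A) : \prod_(a <- map monom s) a =
  ((\prod_(a <- s) a)%:P * 'X^(size s) : {poly A}) :> poly_alg A.
Proof.
elim: s => [|a s IH]; first by rewrite !big_nil /= expr0 mulr1.
by rewrite /= !big_cons IH; exact: mul_monomials.
Qed.

Lemma monom_letters X Y s : all (fun a => (a == monom X) || (a == monom Y)) s ->
  exists2 t, s = map monom t & all (fun a => (a == X) || (a == Y)) t.
Proof.
elim: s => [|a s IH] /=; first by exists [::].
case/andP => aXY /IH[t -> tt]; case/orP: aXY => /eqP ->.
  by exists (X :: t); rewrite /= ?eqxx.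
by exists (Y :: t); rewrite /= ?eqxx ?orbT.
Qed.

Lemma nil_words_monom X Y K : nil_words X Y K -> nil_words (monom X) (monom Y) K.
Proof.
move=> H s /monom_letters[t -> tt]; rewrite size_map => Ks.
rewrite monom_prod (H t) //; exact: mul0r.
Qed.

Lemma left_bracket_monom (s : seq A) :
  left_bracket (@comm R (poly_alg A)) (map monom s) =
  ((left_bracket (@comm R A) s)%:P * 'X^(size s) : {poly A}) :> poly_alg A.
Proof.
case: s => [|b s] /=; first by rewrite mul0r.
rewrite -[b in RHS]/(id b); elim/last_ind: s => [|s c IH] //=.
rewrite map_rcons !foldl_rcons IH size_rcons; set u := foldl _ b s.
change (u%:P * 'X^((size s).+1) * (c%:P * 'X^1) -
    (c%:P * 'X^1) * (u%:P * 'X^((size s).+1))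
  = (u * c - c * u)%:P * 'X^((size s).+2) :> {poly A}).
by rewrite !mul_monomials addn1 add1n polyCB mulrBl.
Qed.

Lemma bch_term_monom X Y m : bch_term (@comm R (poly_alg A)) m (monom X) (monom Y)
  = ((bch_term (@comm R A) m X Y)%:P * 'X^m : {poly A}) :> poly_alg A.
Proof.
have phi_lin : linear (fun a : A => (a%:P * 'X^m : {poly A}) : poly_alg A).
  move=> k u v; apply/polyP => i.
  by rewrite coefD coef_poly_algZ !coefCM mulrDl -scalerAl.
pose phi : {linear A -> poly_alg A} :=
  HB.pack (fun a : A => (a%:P * 'X^m : {poly A}) : poly_alg A)
    (GRing.isLinear.Build _ _ _ _ _ phi_lin).
by apply: (bch_term_morph (phi := phi)) => s sm _; rewrite left_bracket_monom sm.
Qed.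

(** [A] itself need not have a derivation fixing [X] and [Y], so they are replaced by t X and t Y in
    A[t] with the derivation t d/dt. It multiplies degree m by m, which can be divided out once the
    constant term is known to vanish; then t = 1. *)
Lemma nlog_nexp_mul X Y K l : nil_words X Y K -> (4 * K + 4 <= l)%N ->
  nlog l.+1 (nexp l.+1 X * nexp l.+1 Y - 1) =
  \sum_(1 <= m < (2 * K).+1) bch_term (@comm R A) m X Y.
Proof.
move=> nilXY Kl.
have eX Z : euler (monom Z) = monom Z.
  apply/polyP => i; rewrite coef_euler /monom coefCM coefXn.
  by case: eqP => [->|]; rewrite ?scale1r // mulr0 scaler0.
have := derivation_nlog euler_linear euler_mul (eX X) (eX Y)
  (nil_words_monom nilXY) Kl.
set D := nlog l.+1 _ => dD.
have D0 : (D : {poly A})`_0 = 0.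
  rewrite -horner_coef0 horner_nlog01; last by left.
  rewrite hornerD hornerN hornerC horner_mul01; last by left.
  rewrite !horner_nexp01; try by left.
  rewrite /monom !horner_mul01; try by left.
  rewrite !hornerXn !mulr0 ?expr1.
  have nexp0 : nexp l.+1 (0 : A) = 1.
    rewrite /nexp big_ord_recl big1 => [|i _]; last by rewrite expr0n scaler0.
    by rewrite fact0 invr1 scale1r addr0.
  rewrite nexp0 mulr1 subrr /nlog big_nat big1 // => -[//|k] _.
  by rewrite expr0n scaler0.
have DE : D = \sum_(1 <= m < (2 * K).+1)
    ((bch_term (@comm R A) m X Y)%:P * 'X^m : {poly A}) :> {poly A}.
  apply/polyP => -[|i].
    rewrite D0 coef_sum big_nat big1 // => -[//|m] _.
    by rewrite coefCM coefXn mulr0.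
  have /(congr1 (fun p : {poly A} => p`_i.+1)) := dD.
  rewrite coef_euler !coef_sum => e.
  have i0 : i.+1%:R != 0 :> R by rewrite pnatr_eq0.
  apply: (scalerI i0); rewrite e scaler_sumr; apply: eq_bigr => m _.
  rewrite coef_poly_algZ bch_term_monom coefCM coefXn.
  by case: eqP => [->//|_]; rewrite mulr0 !scaler0.
have c1 : (1 : A) = 0 \/ (1 : A) = 1 by right.
have := congr1 (fun p : {poly A} => p.[1]) DE.
rewrite {1}/D horner_nlog01 // hornerD hornerN hornerC horner_mul01 // !horner_nexp01 //.
rewrite /monom !horner_mul01 // !hornerXn ?expr1 !mulr1 !hornerC => ->.
rewrite horner_sum; apply: eq_bigr => m _.
by rewrite horner_mul01 // hornerC hornerXn expr1n mulr1.
Qed.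

End DynkinAlgebra.

(** * The group structure *)

Section BHGroupAlgebra.
Context {R : realType} (M : bhGroup R).
Implicit Types x y z : M.
Local Notation br := (bracket M).

Lemma bracket_linearl a : linear (br^~ a).
Proof. by move=> k u v; rewrite linearPl. Qed.
Lemma bracket_linearr a : linear (br a).
Proof. by move=> k u v; rewrite linearPr. Qed.
Lemma bracketDl x y z : br (x + y) z = br x z + br y z.
Proof. by have := bracket_linearl z 1 x y; rewrite !scale1r. Qed.
Lemma bracketDr x y z : br z (x + y) = br z x + br z y.
Proof. by have := bracket_linearr z 1 x y; rewrite !scale1r. Qed.
Lemma bracket0l x : br 0 x = 0.
Proof. by have := bracket_linearl x (-1) 0 0; rewrite !scaleN1r oppr0 addr0 addNr. Qed.
Lemma bracket0r x : br x 0 = 0.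
Proof. by rewrite bracket_skew bracket0l oppr0. Qed.
Lemma bracketZl k x y : br (k *: x) y = k *: br x y.
Proof. by have := bracket_linearl y k x 0; rewrite !addr0 bracket0l addr0. Qed.
Lemma bracketZr k x y : br x (k *: y) = k *: br x y.
Proof. by rewrite bracket_skew bracketZl -scalerN -bracket_skew. Qed.
Lemma bracketNl x y : br (- x) y = - br x y.
Proof. by rewrite -scaleN1r bracketZl scaleN1r. Qed.
Lemma bracketxx x : br x x = 0.
Proof.
have /eqP := bracket_skew x x; rewrite -subr_eq0 opprK -mulr2n -scaler_nat.
by rewrite scaler_eq0 pnatr_eq0 => /eqP.
Qed.
Lemma bracket_suml I (r : seq I) (P : pred I) (F : I -> M) y :
  br (\sum_(i <- r | P i) F i) y = \sum_(i <- r | P i) br (F i) y.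
Proof.
by apply: (big_morph (fun u => br u y)) => [u v|]; rewrite ?bracketDl ?bracket0l.
Qed.
Lemma bracket_sumr I (r : seq I) (P : pred I) (F : I -> M) y :
  br y (\sum_(i <- r | P i) F i) = \sum_(i <- r | P i) br y (F i).
Proof.
by apply: (big_morph (fun u => br y u)) => [u v|]; rewrite ?bracketDr ?bracket0r.
Qed.

Lemma step_gt0 : (0 < step M)%N.
Proof. by have [] := bracket_nilpotent M. Qed.

Lemma layer0 i : (1 <= i)%N -> layer M i 0.
Proof.
move=> i1; have [si|is_] := leqP i (step M); last by rewrite layer_gt_step.
by have [] := @layer_subspace _ M i; rewrite ?i1.
Qed.

Lemma layerP i k x y : (1 <= i)%N -> layer M i x -> layer M i y ->
  layer M i (k *: x + y).
Proof.
move=> i1; have [si|is_] := leqP i (step M).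
  by have [|_ H] := @layer_subspace _ M i; rewrite ?i1 //; exact: H.
by rewrite layer_gt_step //= => -> ->; rewrite scaler0 addr0.
Qed.

Lemma layerZ i k x : (1 <= i)%N -> layer M i x -> layer M i (k *: x).
Proof. by move=> i1 lx; rewrite -[_ *: _]addr0; apply: layerP => //; exact: layer0. Qed.

Lemma bracket_layerD i j x y : (1 <= i)%N -> (1 <= j)%N ->
  layer M i x -> layer M j y -> layer M (i + j) (br x y).
Proof.
move=> i1 j1 lx ly; have [ijs|sij] := leqP (i + j)%N (step M).
  exact: bracket_layer.
have [si|is_] := leqP i (step M); last first.
  by move: lx; rewrite (layer_gt_step is_) => ->; rewrite bracket0l; apply: layer0; lia.
have [sj|js] := leqP j (step M); last first.
  by move: ly; rewrite (layer_gt_step js) => ->; rewrite bracket0r; apply: layer0; lia.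
by rewrite (bracket_layer0 _ _ sij lx ly) ?i1 ?j1 //; apply: layer0; lia.
Qed.

Lemma proj_linear i : (1 <= i <= step M)%N -> linear (@proj R M i).
Proof.
move=> hi k x y; rewrite -[x in LHS]proj_sum -[y in LHS]proj_sum.
rewrite scaler_sumr -big_split /=.
by apply: (proj_unique (u := fun i => k *: proj i x + proj i y)) => // j hj;
  apply: layerP; rewrite ?(andP hj).1 //; exact: proj_layer.
Qed.

Lemma proj0 i : (1 <= i <= step M)%N -> proj i (0 : M) = 0.
Proof.
by move=> hi; have := proj_linear hi (-1) 0 0; rewrite !scaleN1r oppr0 addr0 addNr.
Qed.

Lemma projZ i k x : (1 <= i <= step M)%N -> proj i (k *: x) = k *: proj i x.
Proof.
by move=> hi; have := proj_linear hi k x 0; rewrite proj0 // !addr0.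
Qed.

Lemma projD i x y : (1 <= i <= step M)%N -> proj i (x + y) = proj i x + proj i y.
Proof. by move=> hi; have := proj_linear hi 1 x y; rewrite !scale1r. Qed.

Lemma proj_of_layer i j x : (1 <= i <= step M)%N -> (1 <= j)%N -> layer M j x ->
  proj i x = if i == j then x else 0.
Proof.
move=> hi j1 lx; have [js|sj] := leqP j (step M); last first.
  move: lx; rewrite (layer_gt_step sj) => ->.
  by rewrite if_same proj0.
rewrite -(proj_unique (u := fun i => if i == j then x else 0) _ hi) => [|k hk].
  congr proj; rewrite (bigD1_seq j) ?mem_index_iota ?iota_uniq ?j1 //= eqxx.
  by rewrite big1 ?addr0 // => k /negPf ->.
by case: eqP => [->//|_]; apply: layer0; case/andP: hk.
Qed.

(** Covers both the dilations, c i = r ^ i, and the degree derivation, c i = i. *)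
Definition grade (c : nat -> R) x := \sum_(1 <= i < (step M).+1) c i *: proj i x.

Lemma grade_linear c : linear (grade c).
Proof.
move=> k x y; rewrite /grade scaler_sumr -big_split /= !big_nat.
apply: eq_bigr => i hi; rewrite proj_linear // scalerDr !scalerA.
by rewrite mulrC.
Qed.

HB.instance Definition _ c := GRing.isLinear.Build _ _ _ _ (grade c) (grade_linear c).

Lemma grade_layer c i x : (1 <= i)%N -> layer M i x -> grade c x = c i *: x.
Proof.
move=> i1 lx; rewrite /grade.
have [is_|si] := leqP i (step M); last first.
  move: lx; rewrite layer_gt_step // => ->; rewrite scaler0 big_nat big1 // => j hj.
  by rewrite (proj_of_layer hj i1) ?if_same ?scaler0 //; exact: layer0.
rewrite (bigD1_seq i) ?mem_index_iota ?iota_uniq ?i1 //=.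
rewrite (proj_of_layer _ i1 lx) ?i1 // eqxx big_nat_cond big1 ?addr0 // => j.
case/andP=> hj ij; rewrite (proj_of_layer hj i1 lx) (negPf ij) scaler0 //.
Qed.

Lemma proj_grade c i x : (1 <= i <= step M)%N -> proj i (grade c x) = c i *: proj i x.
Proof.
move=> hi; apply: (proj_unique (u := fun i => c i *: proj i x)) => // j hj.
by apply: layerZ; [case/andP: hj|exact: proj_layer].
Qed.

Lemma eq_proj x y : (forall i, (1 <= i <= step M)%N -> proj i x = proj i y) -> x = y.
Proof.
move=> H; rewrite -[x]proj_sum -[y]proj_sum !big_nat; apply: eq_bigr => i hi.
exact: H.
Qed.

Lemma bracket_projE x y : br x y = \sum_(1 <= i < (step M).+1)
  \sum_(1 <= j < (step M).+1) br (proj i x) (proj j y).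
Proof.
rewrite -{1}[x]proj_sum bracket_suml; apply: eq_bigr => i _.
by rewrite -{1}[y]proj_sum bracket_sumr.
Qed.

Lemma gradeE c x : grade c x = \sum_(1 <= i < (step M).+1) c i *: proj i x.
Proof. by []. Qed.

Lemma grade_bracket_proj c i j x y : (1 <= i <= step M)%N -> (1 <= j <= step M)%N ->
  grade c (br (proj i x) (proj j y)) = c (i + j)%N *: br (proj i x) (proj j y).
Proof.
move=> hi hj; have [/andP[i1 _] /andP[j1 _]] := (hi, hj).
apply: grade_layer; first by rewrite (leq_trans i1) // leq_addr.
by apply: bracket_layerD => //; exact: proj_layer.
Qed.

Lemma grade_bracketM c x y : (forall i j, c (i + j)%N = c i * c j) ->
  grade c (br x y) = br (grade c x) (grade c y).
Proof.
move=> cM; rewrite [in LHS]bracket_projE linear_sum /= [grade c x]gradeE.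
rewrite bracket_suml !big_nat; apply: eq_bigr => i hi.
rewrite linear_sum /= [grade c y]gradeE bracket_sumr !big_nat.
apply: eq_bigr => j hj.
by rewrite grade_bracket_proj // cM bracketZl bracketZr scalerA.
Qed.

Lemma grade_bracketD c x y : (forall i j, c (i + j)%N = c i + c j) ->
  grade c (br x y) = br (grade c x) y + br x (grade c y).
Proof.
move=> cD; rewrite [in LHS]bracket_projE linear_sum /=.
transitivity (\sum_(1 <= i < (step M).+1)
   (br (c i *: proj i x) y + br (proj i x) (grade c y))); last first.
  by rewrite big_split /= -!bracket_suml proj_sum.
rewrite !big_nat; apply: eq_bigr => i hi.
transitivity (\sum_(1 <= j < (step M).+1)
   (br (c i *: proj i x) (proj j y) + br (proj i x) (c j *: proj j y))); last first.
  by rewrite big_split /= -!bracket_sumr proj_sum.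
rewrite linear_sum /= !big_nat; apply: eq_bigr => j hj.
by rewrite grade_bracket_proj // cD bracketZl bracketZr scalerDl.
Qed.

Lemma foldl_bracket0 (s : seq M) : foldl br 0 s = 0.
Proof. by elim: s => //= a s; rewrite bracket0l. Qed.

Lemma left_bracket_nil (s : seq M) : (step M < size s)%N -> left_bracket br s = 0.
Proof.
have [_ nil _] := bracket_nilpotent M; move=> hs.
have : left_bracket br (take (step M).+1 s) = 0.
  by apply: nil; rewrite size_takel.
rewrite -{2}[s](cat_take_drop (step M).+1).
case: (take _ _) (size_takel hs) => [//|a t] _ /= H.
by rewrite foldl_cat H foldl_bracket0.
Qed.

Lemma gmul_comm x y : br x y = 0 -> gmul x y = x + y.
Proof.
move=> xy0; rewrite /gmul /bch big_nat big1 ?addr0 // => m /andP[m2 _].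
rewrite /bch_term big1 ?scaler0 // => k _; rewrite big1 ?scaler0 // => p _.
rewrite big1 // => q /andP[_ /eqP e].
suff H s : (2 <= size s)%N -> all (fun a => (a == x) || (a == y)) s ->
    left_bracket br s = 0.
  by rewrite H ?scaler0 ?bch_word_letters // size_bch_word e.
case: s => [|a [|b s]] //= _ /and3P[ha hb _].
suff -> : br a b = 0 by exact: foldl_bracket0.
by case/orP: ha => /eqP ->; case/orP: hb => /eqP ->;
  rewrite ?bracketxx ?xy0 // bracket_skew xy0 oppr0.
Qed.

Lemma gmulx0 x : gmul x 0 = x.
Proof. by rewrite gmul_comm ?addr0 ?bracket0r. Qed.
Lemma gmul0x x : gmul 0 x = x.
Proof. by rewrite gmul_comm ?add0r ?bracket0l. Qed.
Lemma gmulZ (a b : R) x : gmul (a *: x) (b *: x) = (a + b) *: x.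
Proof. by rewrite gmul_comm ?scalerDl // bracketZl bracketZr bracketxx !scaler0. Qed.
Lemma gmulNx x : gmul (- x) x = 0.
Proof. by rewrite -scaleN1r -[x in gmul _ x]scale1r gmulZ addNr scale0r. Qed.
Lemma gmulxN x : gmul x (- x) = 0.
Proof. by rewrite -scaleN1r -[x in gmul x _]scale1r gmulZ subrr scale0r. Qed.

(* The degree operator (multiplication by i on the i-th layer) is an invertible
   derivation, hence extends the adjoint representation to a faithful one. *)
Definition rep : M -> rop M :=
  word_op bracket_linearl (grade (fun i => i%:R)).

Lemma repE a w : rep a w = (br w.1 a + w.2 *: grade (fun i => i%:R) a, 0).
Proof. by []. Qed.

Lemma rep_linear : linear rep.
Proof.
move=> k a b; apply: rop_ext => -[v r].
rewrite ropDE ropZE !repE bracket_linearr linearP /=.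
congr (_, _); last by rewrite /= scaler0 addr0.
by rewrite /= !scalerDr !scalerA [r * k]mulrC addrACA.
Qed.
HB.instance Definition _ := GRing.isLinear.Build _ _ _ _ rep rep_linear.

Lemma rep_inj : injective rep.
Proof.
move=> a b ab; apply: eq_proj => i hi.
have := congr1 (fun f : rop M => proj i (f (0, 1)).1) ab.
rewrite !repE /= !bracket0l !add0r !scale1r !proj_grade // => /scalerI; apply.
by rewrite pnatr_eq0 -lt0n; case/andP: hi.
Qed.

(** On vectors of [M] this is the Jacobi identity, and at e the derivation property of the degree
    operator. *)
Lemma rep_bracket a b : rep (br a b) = comm (rep a) (rep b).
Proof.
apply: rop_ext => -[v r]; rewrite /comm ropBE !ropME !repE /=.
congr (_, _); last by rewrite /= subr0.
rewrite grade_bracketD; last by move=> i j; rewrite natrD.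
rewrite !scale0r !addr0 [X in _ = X]/= !bracketDl !bracketZl opprD addrACA -scalerBr.
congr (_ + _ *: _); last by rewrite (bracket_skew a).
have e1 : br a (br b v) = br (br v b) a.
  by rewrite bracket_skew (bracket_skew b v) bracketNl opprK.
have := bracket_jacobi v a b; rewrite e1 (bracket_skew b (br v a)) -addrA => /eqP.
by rewrite addr_eq0 => /eqP ->; rewrite opprD opprK addrC.
Qed.

Lemma rep_left_bracket s : rep (left_bracket br s) = left_bracket (@comm R (rop M)) (map rep s).
Proof.
case: s => [|a s] /=; first by rewrite linear0.
elim/last_ind: s => [//|s b IH].
by rewrite map_rcons !foldl_rcons rep_bracket IH.
Qed.

Lemma nil_words_rep a b : nil_words (rep a) (rep b) (step M).+1.
Proof.
move=> s ss Ks.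
have [t st] : exists t, s = map rep t.
  elim: s ss {Ks} => [|c s IH] /=; first by exists [::].
  by case/andP => /orP[] /eqP -> /IH[t ->]; [exists (a :: t)|exists (b :: t)].
rewrite st size_map in Ks; rewrite st big_map; apply: rop_ext => -[v r].
rewrite prod_word_op -?size_eq0 -?lt0n ?(leq_ltn_trans _ Ks) //.
rewrite left_bracket_nil ?scaler0 ?addr0; last by case: t Ks {st}.
by have := @left_bracket_nil (v :: t); rewrite /= => -> //; rewrite ltnW.
Qed.

Let lrep := (4 * (step M).+1 + 4)%N.

Lemma nlog_rep a b :
  nlog lrep.+1 (nexp lrep.+1 (rep a) * nexp lrep.+1 (rep b) - 1) = rep (gmul a b).
Proof.
rewrite (nlog_nexp_mul (@nil_words_rep a b)) //.
rewrite (big_cat_nat (n := (step M).+1)) //=; last by lia.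
rewrite [X in _ + X]big_nat [X in _ + X]big1 ?addr0 => [|m /andP[hm _]]; last first.
  rewrite (bch_term_morph (br := br) (phi := rep)) => [|s _ _]; last exact: rep_left_bracket.
  rewrite /bch_term big1 ?scaler0 ?linear0 // => k _.
  rewrite big1 ?scaler0 // => p _; rewrite big1 // => q /andP[_ /eqP e].
  by rewrite left_bracket_nil ?scaler0 // size_bch_word e.
rewrite big_ltn ?ltnS ?step_gt0 // bch_term1 /gmul /bch linearD linearD /=; congr (_ + _).
rewrite linear_sum /=; apply: eq_bigr => m _; apply: bch_term_morph => s _ _.
exact: rep_left_bracket.
Qed.

Lemma nexp_rep a b :
  nexp lrep.+1 (rep (gmul a b)) = nexp lrep.+1 (rep a) * nexp lrep.+1 (rep b).
Proof.
rewrite -nlog_rep nexp_nlog //.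
by rewrite (expr_nilp (nil_nexp lrep (@nil_words_rep a b))) // /lrep; lia.
Qed.

Lemma gmulA : associative (@gmul R M).
Proof.
by move=> x y z; apply: rep_inj; rewrite -[LHS]nlog_rep -[RHS]nlog_rep !nexp_rep mulrA.
Qed.

Lemma gmulKx x y : gmul (- x) (gmul x y) = y.
Proof. by rewrite gmulA gmulNx gmul0x. Qed.
Lemma gmulxK x y : gmul x (gmul (- x) y) = y.
Proof. by rewrite gmulA gmulxN gmul0x. Qed.
Lemma gmulIl x y z : gmul x y = gmul x z -> y = z.
Proof. by move=> e; rewrite -[y](gmulKx x) e gmulKx. Qed.

Lemma oppr_gmul x y : - gmul x y = gmul (- y) (- x).
Proof.
apply: (@gmulIl (gmul x y)); rewrite gmulxN -gmulA [gmul y _]gmulA gmulxN.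
by rewrite gmul0x gmulxN.
Qed.

Lemma dilE r x : dil r x = grade (fun i => r ^+ i) x.
Proof. by []. Qed.

Lemma dil_gmul r x y : dil r (gmul x y) = gmul (dil r x) (dil r y).
Proof.
rewrite !dilE /gmul /bch !linearD /=; congr (_ + _).
rewrite linear_sum /=; apply: eq_bigr => m _; apply/esym/bch_term_morph => s _ _.
case: s => [|a s]; first exact: linear0.
rewrite /=; elim/last_ind: s => [//|s b IH].
rewrite map_rcons !foldl_rcons -IH grade_bracketM // => i j.
by rewrite exprD.
Qed.

Lemma proj_dil r i x : (1 <= i <= step M)%N -> proj i (dil r x) = r ^+ i *: proj i x.
Proof. exact: proj_grade. Qed.

Lemma dil_dil r s x : dil r (dil s x) = dil (r * s) x.
Proof.
apply: eq_proj => i hi; rewrite !proj_dil // scalerA; congr (_ *: _).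
by rewrite exprMn.
Qed.

Lemma dil1 x : dil 1 x = x.
Proof. by apply: eq_proj => i hi; rewrite proj_dil // expr1n scale1r. Qed.

Lemma dilr0 r : dil r (0 : M) = 0. Proof. by rewrite dilE linear0. Qed.
Lemma dilN r x : dil r (- x) = - dil r x. Proof. by rewrite !dilE linearN. Qed.

Lemma dil0 x : dil 0 x = 0.
Proof.
apply: eq_proj => i hi; rewrite proj_dil // proj0 // expr0n.
by case: i hi => // i _; rewrite scale0r.
Qed.

Lemma dilK r x : r != 0 -> dil r (dil r^-1 x) = x.
Proof. by move=> r0; rewrite dil_dil divff // dil1. Qed.
Lemma dilVK r x : r != 0 -> dil r^-1 (dil r x) = x.
Proof. by move=> r0; rewrite dil_dil mulVf // dil1. Qed.

Lemma dil_layer r i x : (1 <= i)%N -> layer M i x -> dil r x = r ^+ i *: x.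
Proof. exact: grade_layer. Qed.

End BHGroupAlgebra.

(** * Continuity of the projections and of the group law *)

Section ProjectionBound.
Context {R : realType} (M : bhGroup R).
Implicit Types x y u : M.

Definition layer_norm x : R := \sum_(1 <= i < (step M).+1) `|proj i x|.

Lemma norm_le_layer_norm x : `|x| <= layer_norm x.
Proof. by rewrite -{1}[x]proj_sum; exact: ler_norm_sum. Qed.

Lemma norm_proj_le i x : (1 <= i <= step M)%N -> `|proj i x| <= layer_norm x.
Proof.
move=> hi; rewrite /layer_norm (bigD1_seq i) ?mem_index_iota ?iota_uniq //=.
by rewrite lerDl sumr_ge0.
Qed.

Lemma layer_normB x y : layer_norm (x - y) <= layer_norm x + layer_norm y.
Proof.
rewrite /layer_norm -big_split /= big_nat [leRHS]big_nat; apply: ler_sum => i hi.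
by rewrite -scaleN1r projD // projZ // scaleN1r ler_normB.
Qed.

Lemma layer_normZ k x : layer_norm (k *: x) = `|k| * layer_norm x.
Proof.
rewrite /layer_norm mulr_sumr !big_nat; apply: eq_bigr => i hi.
by rewrite projZ // normrZ.
Qed.

Lemma layer_norm_ge0 x : 0 <= layer_norm x.
Proof. exact: sumr_ge0. Qed.

(* The Baire category half of the open mapping theorem, for the sum map from
   the product of the layers. *)
Lemma layer_norm_approx : exists2 C : R, 0 < C & forall y (e : R), 0 < e ->
  exists2 u, layer_norm u <= C * `|y| & `|y - u| < e.
Proof.
pose B (n : nat) := [set x : M | layer_norm x <= n%:R].
have : exists n, ~ dense (~` closure (B n)).
  apply/existsNP => dB.
  have /(_ setT) [] : dense (\bigcap_n ~` closure (B n)).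
    by apply: Baire => i; split; [exact/closed_openC/closed_closure|exact: dB].
  - by exists 0.
  - exact: openT.
  - move=> x [_ /(_ (Num.bound (layer_norm x)) I)]; apply.
    by apply: subset_closure; rewrite /B /= ltW // archi_boundP // layer_norm_ge0.
move=> [n] /existsNP[U] /not_implyP[[x0 Ox0]] /not_implyP[oO OB].
have Ocl : U `<=` closure (B n).
  by move=> x Ox; apply: contrapT => nx; apply: OB; exists x.
have [r /= r0 rO] : exists2 r : R, 0 < r & ball x0 r `<=` U.
  by apply/nbhs_ballP; exact: open_nbhs_nbhs.
have appr y (e : R) : ball x0 r y -> 0 < e -> exists2 u, B n u & `|y - u| < e.
  move=> yr e0; have /(_ (ball y e)) [] := Ocl _ (rO _ yr).
    exact: nbhsx_ballx.
  by move=> u [Bu]; rewrite -ball_normE /= => yu; exists u.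
(* Approximants of x0 + y and of x0 are subtracted to move the ball to the origin, which doubles the
   bound n. *)
have small y (e : R) : `|y| < r -> 0 < e ->
    exists2 u, layer_norm u <= n%:R + n%:R & `|y - u| < e.
  move=> yr e0; have e2 : 0 < e / 2 by rewrite divr_gt0.
  have [|u1 Bu1 h1] := appr (x0 + y) (e / 2) _ e2.
    by rewrite -ball_normE /= opprD addrA subrr add0r normrN.
  have [u2 Bu2 h2] := appr x0 (e / 2) (ballxx _ r0) e2.
  exists (u1 - u2); first by rewrite (le_trans (layer_normB _ _)) // lerD.
  have -> : y - (u1 - u2) = (x0 + y - u1) - (x0 - u2).
    rewrite !opprB [x0 + y]addrC -!addrA; congr (_ + _).
    by rewrite [RHS]addrC -!addrA addNr addr0 addrC.
  by rewrite (le_lt_trans (ler_normB _ _)) // [e]splitr ltrD.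
(* The factor 2 / r comes from rescaling y to norm r / 2; the summand 1 keeps the constant positive
   when n = 0. *)
exists ((n%:R + n%:R) * (2 / r) + 1) => [|y e e0].
  by rewrite ltr_pwDr // mulr_ge0 ?addr_ge0 // divr_ge0 // ltW.
have [->|y0] := eqVneq y 0.
  exists 0; last by rewrite subrr normr0.
  by rewrite normr0 mulr0 -(scale0r (0 : M)) layer_normZ normr0 mul0r.
have ny0 : 0 < `|y| by rewrite normr_gt0.
pose k := r / 2 / `|y|.
have k0 : 0 < k by rewrite !divr_gt0.
have [||u hu1 hu2] := small (k *: y) (k * e); first 2 last.
- exists (k^-1 *: u).
    rewrite layer_normZ gtr0_norm ?invr_gt0 // /k !invfM !invrK.
    rewrite mulrDl mul1r (@le_trans _ _ ((n%:R + n%:R) * (2 / r) * `|y|)) //.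
      have -> : r^-1 * 2 * `|y| * layer_norm u = layer_norm u * (2 / r) * `|y| by ring.
      by rewrite ler_wpM2r // ler_wpM2r // divr_ge0 // ltW.
    by rewrite lerDl.
  have -> : y - k^-1 *: u = k^-1 *: (k *: y - u).
    by rewrite scalerBr scalerA mulVf ?scale1r // gt_eqF.
  rewrite normrZ gtr0_norm ?invr_gt0 // mulrC ltr_pdivrMr //.
  by rewrite mulrC.
- rewrite normrZ gtr0_norm // /k divfK ?gt_eqF //.
  by rewrite ltr_pdivrMr // mulr_natr mulr2n ltrDl.
- by rewrite mulr_gt0.
Qed.

(** The iterative half of the open mapping argument. Correcting the remainder repeatedly writes y as
    a series of vectors with geometrically small layer norms. Their components converge by
    completeness, the limits stay in the closed layers, and by uniqueness of the decomposition they
    are the components of y. *)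
Lemma proj_bounded : exists2 C : R, 0 < C & forall i x, (1 <= i <= step M)%N ->
  `|proj i x| <= C * `|x|.
Proof.
have [C C0 HC] := layer_norm_approx.
exists (2 * C); first by rewrite mulr_gt0.
move=> i0 y hi0.
have [->|yn0] := eqVneq y 0; first by rewrite proj0 // !normr0 mulr0.
have a0 : 0 < `|y| by rewrite normr_gt0.
have /choice[g Hg] : forall ne : nat * M, exists u, layer_norm u <= C * `|ne.2| /\
    `|ne.2 - u| < `|y| / 2 ^+ ne.1.+1.
  move=> [n z] /=; have [|u h1 h2] := HC z (`|y| / 2 ^+ n.+1).
    by rewrite divr_gt0 // exprn_gt0.
  by exists u.
pose rem := fix rem n := if n is m.+1 then rem m - g (m, rem m) else y.
pose u n := g (n, rem n).
have remE n : rem n.+1 = rem n - u n by [].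
have rem_le n : `|rem n| <= `|y| / 2 ^+ n.
  case: n => [|n]; first by rewrite expr0 divr1.
  by rewrite remE ltW //; have [] := Hg (n, rem n).
have u_le n : layer_norm (u n) <= C * `|y| / 2 ^+ n.
  have [h _] := Hg (n, rem n); rewrite (le_trans h) // -mulrA ler_wpM2l ?(ltW C0) //.
  exact: rem_le.
have remS n : rem n = y - \sum_(k < n) u k.
  elim: n => [|n IH]; first by rewrite big_ord0 subr0.
  by rewrite remE IH big_ord_recr /= opprD addrA.
have geo n : \sum_(k < n) C * `|y| / 2 ^+ k <= 2 * (C * `|y|).
  suff -> : \sum_(k < n) C * `|y| / 2 ^+ k = 2 * (C * `|y|) - 2 * (C * `|y|) / 2 ^+ n.
    by rewrite lerBlDr lerDl divr_ge0 ?exprn_ge0 // mulr_ge0 // mulr_ge0 // ltW.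
  elim: n => [|n IH]; first by rewrite big_ord0 expr0 divr1 subrr.
  rewrite big_ord_recr /= IH exprS; field.
  by rewrite expf_neq0 // pnatr_eq0.
pose s i n := \sum_(k < n) proj i (u k).
have s_le i n : (1 <= i <= step M)%N -> `|s i n| <= 2 * (C * `|y|).
  move=> hi; rewrite (le_trans (ler_norm_sum _ _ _)) // (le_trans _ (geo n)) //.
  apply: ler_sum => k _; exact: le_trans (norm_proj_le _ hi) (u_le k).
have s_cvg i : (1 <= i <= step M)%N -> cvgn (s i).
  move=> hi; have -> : s i = series (fun k => proj i (u k)).
    by apply/funext => n; rewrite /s /series /= big_mkord.
  apply: normed_cvg; apply: (@series_le_cvg _ _ (geometric (C * `|y|) 2^-1)).
  - by move=> n /=.
  - by move=> n; rewrite /geometric /= mulr_ge0 ?exprn_ge0 // mulr_ge0 // ltW.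
  - move=> n; rewrite /geometric /= exprVn.
    exact: le_trans (norm_proj_le _ hi) (u_le n).
  - by apply: is_cvg_geometric_series; rewrite ger0_norm // invf_lt1 // ltr1n.
have s_layer i n : (1 <= i <= step M)%N -> layer M i (s i n).
  move=> hi; rewrite /s; elim/big_ind: _ => [|a b ha hb|k _].
  - by apply: layer0; case/andP: hi.
  - by rewrite -[a]scale1r; apply: layerP => //; case/andP: hi.
  - exact: proj_layer.
pose l i := limn (s i).
have l_layer i : (1 <= i <= step M)%N -> layer M i (l i).
  move=> hi; apply: (@closed_cvg _ _ _ eventually_filter _ (layer M i)); last exact: s_cvg.
    exact: layer_closed.
  by near=> n; exact: s_layer.
have yE : \sum_(1 <= i < (step M).+1) l i = y.
  have h1 : (fun n => \sum_(1 <= i < (step M).+1) s i n) @ \oo -->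
      \sum_(1 <= i < (step M).+1) l i.
    rewrite big_nat; under eq_fun do rewrite big_nat.
    by apply: cvg_big => [|i hi]; [exact: add_continuous|exact: s_cvg].
  have h2 : (fun n => \sum_(1 <= i < (step M).+1) s i n) @ \oo --> y.
    apply/cvgrPdist_le => e e0.
    have : (fun n => `|y| * (2^-1 : R) ^+ n) @ \oo --> 0.
      have := @cvg_geometric R `|y| 2^-1; apply.
      by rewrite ger0_norm // invf_lt1 // ltr1n.
    move=> /cvgrPdist_le /(_ _ e0) [N _ HN]; exists N => // n Nn /=.
    have -> : \sum_(1 <= i < (step M).+1) s i n = \sum_(k < n) u k.
      rewrite /s exchange_big /=; apply: eq_bigr => k _; exact: proj_sum.
    rewrite -remS (le_trans (rem_le n)) //.
    have := HN n Nn; rewrite /= sub0r normrN exprVn.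
    by rewrite ger0_norm // divr_ge0 // exprn_ge0.
  exact: (cvg_unique _ h1 h2).
have <- : l i0 = proj i0 y by rewrite -yE; apply/esym/proj_unique.
have nl : `|s i0 n| @[n --> \oo] --> `|l i0| by apply: cvg_norm; exact: s_cvg.
rewrite -mulrA -(cvg_lim (@Rhausdorff R) nl); apply: limr_le; first exact: cvgP nl.
by near=> n; exact: s_le.
Unshelve. all: by end_near. Qed.

End ProjectionBound.

Lemma seq_radius (R : realType) (I : eqType) (s : seq I) (P : I -> R -> Prop) :
  (forall i q r, P i r -> q <= r -> P i q) ->
  (forall i, i \in s -> exists2 r, 0 < r & P i r) ->
  exists2 r, 0 < r & forall i, i \in s -> P i r.
Proof.
move=> mono; elim: s => [|i s IH] H; first by exists 1.
have [|r r0 hr] := IH; first by move=> j js; apply: H; rewrite inE js orbT.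
have [q q0 hq] := H i (mem_head _ _); exists (Num.min q r); first by rewrite lt_min q0.
move=> j; rewrite inE => /orP[/eqP ->|js].
  by apply: mono hq _; rewrite ge_min lexx.
by apply: mono (hr j js) _; rewrite ge_min lexx orbT.
Qed.

Lemma nat_interval_radius (R : realType) (n : nat) (P : nat -> R -> Prop) :
  (forall i q r, P i r -> q <= r -> P i q) ->
  (forall i, (1 <= i <= n)%N -> exists2 r, 0 < r & P i r) ->
  exists2 r, 0 < r & forall i, (1 <= i <= n)%N -> P i r.
Proof.
move=> mono H; have [i|r r0 hr] := @seq_radius R nat (index_iota 1 n.+1) P mono.
  by rewrite mem_index_iota; exact: H.
by exists r => // i hi; apply: hr; rewrite mem_index_iota.
Qed.

Section BHNorm.
Context {R : realType} (M : bhGroup R) (sigma : nat -> R).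
Hypothesis sigmaP : norm_constants M sigma.
Implicit Types x y w : M.
Local Notation N := (@bh_norm R M sigma).

Lemma sigma_gt0 i : (1 <= i <= step M)%N -> 0 < sigma i.
Proof. by have [_ + _] := sigmaP; exact. Qed.

Lemma bh_norm_gmul x y : N (gmul x y) <= N x + N y.
Proof. by have [_ _] := sigmaP; exact. Qed.

Lemma bh_norm_ge0 x : 0 <= N x.
Proof. exact: bigmax_ge_id. Qed.

Lemma bh_norm_leP x c : 0 <= c ->
  (forall i, (1 <= i <= step M)%N -> sigma i * `|proj i x| `^ i%:R^-1 <= c) ->
  N x <= c.
Proof. by move=> c0 H; rewrite /bh_norm big_nat; apply: bigmax_le. Qed.

Lemma bh_norm_proj i x : (1 <= i <= step M)%N ->
  sigma i * `|proj i x| `^ i%:R^-1 <= N x.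
Proof.
move=> hi.
apply: (@le_bigmax_seq _ _ _ _ _ i xpredT
  (fun i => sigma i * `|proj i x| `^ i%:R^-1)) => //.
by rewrite mem_index_iota.
Qed.

Lemma bh_normN x : N (- x) = N x.
Proof.
rewrite /bh_norm !big_nat; apply: eq_bigr => i hi.
by rewrite -scaleN1r projZ // scaleN1r normrN.
Qed.

Lemma natr_inv_neq0 i : (1 <= i)%N -> (i%:R^-1 : R) != 0.
Proof. by move=> i1; rewrite invr_eq0 pnatr_eq0 -lt0n. Qed.

Lemma bh_norm0 : N 0 = 0.
Proof.
apply/eqP; rewrite eq_le bh_norm_ge0 andbT; apply: bh_norm_leP => // i hi.
rewrite proj0 // normr0 powR0 ?mulr0 //.
by apply: natr_inv_neq0; case/andP: hi.
Qed.

Lemma bh_norm_eq0 x : N x = 0 -> x = 0.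
Proof.
move=> x0; apply: eq_proj => i hi; rewrite proj0 //.
have := bh_norm_proj x hi; rewrite x0 pmulr_rle0 ?sigma_gt0 // => h.
have /powR_eq0_eq0 /normr0P/eqP // : `|proj i x| `^ i%:R^-1 = 0.
by apply/eqP; rewrite eq_le h powR_ge0.
Qed.

Lemma powR_exprn_inv (t : R) i : 0 <= t -> (1 <= i)%N -> (t ^+ i) `^ i%:R^-1 = t.
Proof.
move=> t0 i1; rewrite -powR_mulrn // -powRrM divff ?powRr1 //.
by rewrite pnatr_eq0 -lt0n.
Qed.

Lemma bh_norm_dil_le t x : 0 <= t -> N (dil t x) <= t * N x.
Proof.
move=> t0; apply: bh_norm_leP => [|i hi]; first by rewrite mulr_ge0 ?bh_norm_ge0.
rewrite proj_dil // normrZ ger0_norm ?exprn_ge0 // powRM ?exprn_ge0 //.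
have [i1 _] := andP hi; rewrite powR_exprn_inv // mulrCA.
by apply: ler_wpM2l => //; exact: bh_norm_proj.
Qed.

Lemma bh_norm_dil t x : 0 <= t -> N (dil t x) = t * N x.
Proof.
rewrite le_eqVlt => /orP[/eqP <-|t0]; first by rewrite dil0 mul0r bh_norm0.
have ti0 : 0 <= t^-1 by rewrite invr_ge0 ltW.
have := bh_norm_dil_le (dil t x) ti0; rewrite dilVK ?gt_eqF // ler_pdivlMl // => h.
by apply/eqP; rewrite eq_le h andbT; apply: bh_norm_dil_le; exact: ltW.
Qed.

(** Together with [bh_norm_small_norm]: the two norms have the same neighbourhoods of 0, so limits
    taken in the Banach space can be used for the homogeneous distance. *)
Lemma norm_small_bh_norm (e : R) : 0 < e ->
  exists2 r, 0 < r & forall w, `|w| <= r -> N w <= e.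
Proof.
move=> e0; have [C C0 HC] := proj_bounded M.
have [|i hi|r r0 hr] := @nat_interval_radius R (step M)
  (fun i r => forall w, `|w| <= r -> sigma i * `|proj i w| `^ i%:R^-1 <= e).
- by move=> i r s H sr w ws; apply: H; exact: le_trans ws sr.
- have si0 := sigma_gt0 hi; have [i1 _] := andP hi.
  exists ((e / sigma i) ^+ i / C) => [|w hw]; first by rewrite divr_gt0 // exprn_gt0 // divr_gt0.
  rewrite mulrC -ler_pdivlMr //.
  have -> : e / sigma i = ((e / sigma i) ^+ i) `^ i%:R^-1.
    by rewrite powR_exprn_inv // ltW // divr_gt0.
  apply: ge0_ler_powR; rewrite ?nnegrE ?invr_ge0 ?ler0n ?normr_ge0 //.
    by rewrite exprn_ge0 // ltW // divr_gt0.
  by rewrite (le_trans (HC _ _ hi)) // mulrC -ler_pdivlMr.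
exists r => // w wr; apply: bh_norm_leP => [|i hi]; [exact: ltW|exact: hr].
Qed.

Lemma bh_norm_small_norm (e : R) : 0 < e ->
  exists2 r, 0 < r & forall w, N w <= r -> `|w| <= e.
Proof.
move=> e0; have n0 := step_gt0 M.
have [|i hi|r r0 hr] := @nat_interval_radius R (step M)
  (fun i r => 0 <= r -> forall w, N w <= r -> `|proj i w| <= e / (step M)%:R).
- move=> i r s H sr s0 w ws; apply: H; first exact: le_trans s0 sr.
  exact: le_trans ws sr.
- have si0 := sigma_gt0 hi; have [i1 _] := andP hi.
  have a0 : 0 < e / (step M)%:R by rewrite divr_gt0 // ltr0n.
  exists (sigma i * (e / (step M)%:R) `^ i%:R^-1) => [|_ w hw].
    by rewrite mulr_gt0 // powR_gt0.
  have := le_trans (bh_norm_proj w hi) hw; rewrite ler_pM2l //.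
  move=> /(@ge0_ler_powR _ i%:R (ler0n _ _)).
  rewrite !nnegrE !powR_ge0 => /(_ isT isT); rewrite -!powRrM mulVf ?pnatr_eq0 -?lt0n //.
  by rewrite !powRr1 // ltW.
exists r => // w wr; rewrite (le_trans (norm_le_layer_norm w)) // /layer_norm big_nat.
rewrite (@le_trans _ _ (\sum_(1 <= i < (step M).+1 | (1 <= i < (step M).+1)%N) e / (step M)%:R)) //.
  by apply: ler_sum => i hi; apply: hr => //; exact: ltW.
rewrite -big_nat big_const_nat iter_addr_0 subSS subn0 -[leLHS]mulr_natr divfK //.
by rewrite pnatr_eq0 -lt0n.
Qed.

Lemma cvg_bracket {T : Type} (F : set_system T) {FF : Filter F} (u v : T -> M) a b :
  u @ F --> a -> v @ F --> b -> (fun t => bracket M (u t) (v t)) @ F --> bracket M a b.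
Proof.
move=> ua vb.
apply: (@cvg_comp _ _ _ (fun t => (u t, v t)) (fun xy => bracket M xy.1 xy.2) F
  (nbhs (a, b))); last exact: (@bracket_continuous _ M (a, b)).
exact: cvg_pair ua vb.
Qed.

Lemma cvg_foldl_bracket {T : Type} (F : set_system T) {FF : Filter F}
    (u : T -> M) a (vs : seq (T -> M)) (bs : seq M) :
  u @ F --> a -> size vs = size bs ->
  (forall i, (i < size vs)%N -> (nth (cst 0) vs i) @ F --> nth 0 bs i) ->
  (fun t => foldl (bracket M) (u t) (map (fun v => v t) vs)) @ F
    --> foldl (bracket M) a bs.
Proof.
elim: vs bs u a => [|v vs IH] [|b bs] u a //= ua [sz] H.
apply: (IH bs (fun t => bracket M (u t) (v t)) (bracket M a b)) => // [|i hi].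
  by apply: cvg_bracket => //; exact: (H 0%N).
exact: (H i.+1).
Qed.

Lemma cvg_gmul {T : Type} (F : set_system T) {FF : Filter F} (u v : T -> M) a b :
  u @ F --> a -> v @ F --> b -> (fun t => gmul (u t) (v t)) @ F --> gmul a b.
Proof.
move=> ua vb; rewrite /gmul /bch.
apply: cvgD; first exact: cvgD.
apply: cvg_big => [|m _]; first exact: add_continuous.
rewrite /bch_term; apply: cvgZl_tmp; apply: cvg_big => [|k _]; first exact: add_continuous.
apply: cvgZl_tmp; apply: cvg_big => [|p _]; first exact: add_continuous.
apply: cvg_big => [|q _]; first exact: add_continuous.
apply: cvgZl_tmp.
under eq_fun do rewrite bch_word_shape.
rewrite (bch_word_shape p q a b).
case: (bch_word p q 1 0) => [|c s] /=; first exact: cvg_cst.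
have := @cvg_foldl_bracket T F FF (fun t => if c == 1 then u t else v t)
  (if c == 1 then a else b) (map (fun (c : R^o) t => if c == 1 then u t else v t) s)
  (map (fun c : R^o => if c == 1 then a else b) s).
rewrite !size_map; under [X in _ -> _ -> _ -> X @ _ --> _]eq_fun do rewrite -map_comp.
apply => //; first by case: ifP.
move=> i hi; rewrite (nth_map 0) // (nth_map 0) //.
by case: ifP.
Qed.

Lemma bh_norm_conj b (e : R) : 0 < e ->
  exists2 r, 0 < r & forall w, N w <= r -> N (gmul (- b) (gmul w b)) <= e.
Proof.
move=> e0; have [r r0 Hr] := norm_small_bh_norm e0.
have : (fun w => gmul (- b) (gmul w b)) @ (0 : M) --> gmul (- b) (gmul 0 b).
  apply: cvg_gmul; first exact: cvg_cst.
  by apply: cvg_gmul; [exact: cvg_id|exact: cvg_cst].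
rewrite gmul0x gmulNx => /cvgr0Pnorm_le /(_ _ r0) /nbhs_ballP[s /= s0 Hs].
have [q q0 Hq] := bh_norm_small_norm (@divr_gt0 _ s 2 s0 (ltr0Sn _ _)).
exists q => // w wq; apply: Hr; apply: Hs; rewrite -ball_normE /= sub0r normrN.
by rewrite (le_lt_trans (Hq w wq)) // ltr_pdivrMr // mulr_natr mulr2n ltrDl.
Qed.

Lemma cvg_bh_norm {T : Type} (F : set_system T) {FF : Filter F} (u : T -> M) a (e : R) :
  u @ F --> a -> 0 < e -> \forall t \near F, N (gmul (- a) (u t)) <= e.
Proof.
move=> ua e0; have [r r0 Hr] := norm_small_bh_norm e0.
have : (fun t => gmul (- a) (u t)) @ F --> gmul (- a) a.
  by apply: cvg_gmul => //; exact: cvg_cst.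
rewrite gmulNx => /cvgr0Pnorm_le /(_ _ r0); apply: filterS => t; exact: Hr.
Qed.

End BHNorm.

(** * Polynomial curves in homogeneous groups *)

(** The properties common to [d^~ 0] on [G] and to the norm of [M], so that both groups are treated
    alike. *)
Record homnorm (R : realType) (G : bhGroup R) (n : G -> R) : Prop := HomNorm {
  homnorm_ge0 : forall x, 0 <= n x;
  homnorm_eq0 : forall x, n x = 0 -> x = 0;
  homnormN : forall x, n (- x) = n x;
  homnorm_gmul : forall x y, n (gmul x y) <= n x + n y;
  homnorm_dil : forall t x, 0 <= t -> n (dil t x) = t * n x }.

Lemma homnorm_bh_norm (R : realType) (M : bhGroup R) (sigma : nat -> R) :
  norm_constants M sigma -> homnorm (@bh_norm R M sigma).
Proof.
move=> sP; split.
- exact: bh_norm_ge0.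
- exact: bh_norm_eq0.
- exact: bh_normN.
- exact: bh_norm_gmul.
- by move=> t x; exact: bh_norm_dil.
Qed.

Section HomogeneousDistance.
Context {R : realType} (G : bhGroup R) (d : G -> G -> R).
Hypothesis dP : homogeneous_distance d.

Lemma hdist_gmul x y : d x y = d (gmul (- y) x) 0.
Proof. by have [_ _ _ dl _] := dP; rewrite -(dl x y (- y)) gmulNx. Qed.

Lemma homnorm_hdist : homnorm (d^~ 0).
Proof.
have [[d0 deq] dC dtri dl ddil] := dP; split.
- by move=> x; exact: d0.
- by move=> x /deq.
- by move=> x; rewrite -(dl (- x) 0 x) gmulxN gmulx0 dC.
- by move=> x y; rewrite addrC (le_trans (dtri _ x _)) // lerD2r -{2}[x]gmulx0 dl.
- move=> t x; rewrite le_eqVlt => /orP[/eqP <-|t0].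
    by rewrite dil0 mul0r; apply/deq.
  by rewrite -{1}(dilr0 G t) ddil.
Qed.

End HomogeneousDistance.

Section PolynomialCurves.
Context {R : realType} (G : bhGroup R).
Implicit Types (x y : G) (p q r : R -> G).
Local Notation br := (bracket G).

(** The ideal H_j + ... + H_step. *)
Definition filt (j : nat) x := forall i, (1 <= i <= step G)%N -> (i < j)%N -> proj i x = 0.

Lemma filtP j k x y : filt j x -> filt j y -> filt j (k *: x + y).
Proof.
by move=> fx fy i hi ij; rewrite proj_linear // fx // fy // scaler0 addr0.
Qed.

Lemma filt0 j : filt j 0.
Proof. by move=> i hi _; rewrite proj0. Qed.

Lemma filtW i j x : (i <= j)%N -> filt j x -> filt i x.
Proof. by move=> ij fx k hk ki; apply: fx => //; exact: leq_trans ki ij. Qed.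

Lemma filt_bracket i j x y : filt i x -> filt j y -> filt (i + j) (br x y).
Proof.
move=> fx fy k hk kij; rewrite bracket_projE.
have PD u v : proj k u = 0 -> proj k v = 0 -> proj k (u + v) = 0 :> G.
  by move=> Pu Pv; rewrite projD // Pu Pv addr0.
rewrite big_nat; apply: (big_ind (fun z => proj k z = 0)) => //; first exact: proj0.
move=> a ha; rewrite big_nat.
apply: (big_ind (fun z => proj k z = 0)) => //; first exact: proj0.
move=> b hb.
have [ai|ia] := ltnP a i; first by rewrite fx // bracket0l proj0.
have [bj|jb] := ltnP b j; first by rewrite (fy b) // bracket0r proj0.
have [a1 _] := andP ha; have [b1 _] := andP hb.
rewrite (@proj_of_layer _ _ k (a + b)%N) //.
- by case: eqP => // kab; move: kij ia jb; rewrite kab; clear; lia.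
- by rewrite (leq_trans a1) // leq_addr.
- by apply: bracket_layerD => //; exact: proj_layer.
Qed.

Inductive poly_curve (j : nat) : (R -> G) -> Prop :=
| poly_curve_monom k x : filt j x -> poly_curve j (fun t => t ^+ k *: x)
| poly_curveD p q : poly_curve j p -> poly_curve j q ->
    poly_curve j (fun t => p t + q t).

Lemma poly_curve_ext j p q : p =1 q -> poly_curve j p -> poly_curve j q.
Proof. by move=> /funext ->. Qed.

Lemma poly_curve_cst j x : filt j x -> poly_curve j (fun=> x).
Proof.
move=> fx; apply: poly_curve_ext (poly_curve_monom 0 fx) => t.
by rewrite expr0 scale1r.
Qed.

Lemma poly_curveZ j c p : poly_curve j p -> poly_curve j (fun t => c *: p t).
Proof.
elim=> [k x fx|p1 p2 _ IH1 _ IH2].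
  apply: (@poly_curve_ext _ (fun t => t ^+ k *: (c *: x))) => [t|].
    by rewrite !scalerA mulrC.
  apply: poly_curve_monom; rewrite -[c *: x]addr0.
  by apply: filtP => //; exact: filt0.
by apply: poly_curve_ext (poly_curveD IH1 IH2) => t; rewrite scalerDr.
Qed.

Lemma poly_curveN j p : poly_curve j p -> poly_curve j (fun t => - p t).
Proof.
by move=> /(poly_curveZ (-1)); apply: poly_curve_ext => t; rewrite scaleN1r.
Qed.

Lemma poly_curveW i j p : (i <= j)%N -> poly_curve j p -> poly_curve i p.
Proof.
move=> ij; elim=> [k x fx|p1 p2 _ IH1 _ IH2]; last exact: poly_curveD.
by apply: poly_curve_monom; exact: filtW fx.
Qed.

Lemma poly_curve_bracket i j p q : poly_curve i p -> poly_curve j q ->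
  poly_curve (i + j) (fun t => br (p t) (q t)).
Proof.
move=> pp pq; elim: pp => [k x fx|p1 p2 _ IH1 _ IH2]; last first.
  by apply: poly_curve_ext (poly_curveD IH1 IH2) => t; rewrite bracketDl.
elim: pq => [l y fy|q1 q2 _ IH1 _ IH2]; last first.
  by apply: poly_curve_ext (poly_curveD IH1 IH2) => t; rewrite bracketDr.
apply: poly_curve_ext (poly_curve_monom (k + l) (filt_bracket fx fy)) => t.
by rewrite bracketZl bracketZr scalerA exprD.
Qed.

Lemma poly_curve_sum j I (s : seq I) (P : pred I) (F : I -> R -> G) :
  (forall i, P i -> poly_curve j (F i)) ->
  poly_curve j (fun t => \sum_(i <- s | P i) F i t).
Proof.
move=> H; elim: s => [|i s IH].
  by under eq_fun do rewrite big_nil; apply: poly_curve_cst; exact: filt0.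
under eq_fun do rewrite big_cons.
case Pi: (P i); last exact: IH.
by apply: poly_curveD => //; exact: H.
Qed.

(** The terms of degree at least 2 are brackets of curves in [filt j], hence lie in [filt (j + j)],
    and j + j > j. Modulo [filt j.+1] the product is therefore the sum. *)
Lemma poly_curve_gmul_sub j p q : (1 <= j)%N -> poly_curve j p -> poly_curve j q ->
  poly_curve j.+1 (fun t => gmul (p t) (q t) - (p t + q t)).
Proof.
move=> j1 pp pq; rewrite /gmul /bch.
under eq_fun do rewrite addrAC subrr add0r big_nat.
apply: poly_curve_sum => m /andP[m2 _]; apply: poly_curveZ.
apply: poly_curve_sum => k _; apply: poly_curveZ.
apply: poly_curve_sum => a _; apply: poly_curve_sum => b ab.
have [_ /eqP e] := andP ab.
apply: poly_curveZ.
pose c (s : R^o) : R -> G := if s == 1 then p else q.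
have pc s : poly_curve j (c s) by rewrite /c; case: ifP.
apply: (@poly_curve_ext _ (fun t => left_bracket br (map (fun s => c s t)
    (bch_word a b 1 0)))) => [t|].
  rewrite (bch_word_shape a b (p t)); congr left_bracket; apply: eq_map => s.
  by rewrite /c; case: ifP.
have : (2 <= size (bch_word a b (1 : R^o) 0))%N by rewrite size_bch_word e.
case: (bch_word a b 1 0) => [|s1 [|s2 s]] //= _.
have H s0 r : poly_curve j.+1 r ->
    poly_curve j.+1 (fun t => foldl br (r t) [seq c s3 t | s3 <- s0]).
  elim: s0 r => [//|s3 s0 IH] r pr /=.
  apply: (IH (fun t => br (r t) (c s3 t))).
  apply: (@poly_curveW _ (j.+1 + j)); first by rewrite leq_addr.
  exact: poly_curve_bracket.
apply: (H s (fun t => br (c s1 t) (c s2 t))).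
apply: (@poly_curveW _ (j + j)); first by rewrite -add1n leq_add2r.
exact: poly_curve_bracket.
Qed.

Lemma poly_curve_gmul j p q : (1 <= j)%N -> poly_curve j p -> poly_curve j q ->
  poly_curve j (fun t => gmul (p t) (q t)).
Proof.
move=> j1 pp pq; have := poly_curve_gmul_sub j1 pp pq.
move=> /(poly_curveW (leqnSn j)) h.
by apply: poly_curve_ext (poly_curveD h (poly_curveD pp pq)) => t; rewrite subrK.
Qed.

Lemma poly_curve_split j p : (1 <= j <= step G)%N -> poly_curve j p ->
  exists (s : seq (nat * G)) r, [/\ forall kh, kh \in s -> layer G j kh.2,
    poly_curve j.+1 r & forall t, p t = \sum_(kh <- s) t ^+ kh.1 *: kh.2 + r t].
Proof.
move=> hj; have [j1 _] := andP hj.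
elim=> [k x fx|p1 p2 _ [s1 [r1 [h1 pr1 e1]]] _ [s2 [r2 [h2 pr2 e2]]]].
  exists [:: (k, proj j x)], (fun t => t ^+ k *: (x - proj j x)); split.
  - by move=> kh; rewrite inE => /eqP -> /=; exact: proj_layer.
  - apply: poly_curve_monom => i hi; rewrite ltnS => ij.
    rewrite -scaleN1r projD // projZ // scaleN1r.
    rewrite (@proj_of_layer _ _ i j _ hi j1 (proj_layer _ hj)).
    move: ij; rewrite leq_eqVlt => /orP[/eqP ->|ij]; first by rewrite eqxx subrr.
    by rewrite ltn_eqF // subr0 fx.
  - by move=> t; rewrite big_seq1 /= -scalerDr addrC subrK.
exists (s1 ++ s2), (fun t => r1 t + r2 t); split.
- by move=> kh; rewrite mem_cat => /orP[/h1|/h2].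
- exact: poly_curveD.
- by move=> t; rewrite e1 e2 big_cat addrACA.
Qed.

End PolynomialCurves.

Section HomNormCurves.
Context {R : realType} (G : bhGroup R) (n : G -> R).
Hypothesis nP : homnorm n.
Implicit Types (x y : G) (p q r : R -> G).

Lemma homnorm0 : n 0 = 0.
Proof. by rewrite -(dil0 (0 : G)) homnorm_dil // mul0r. Qed.

(** Homogeneity gives the bound, since t ^ k x = dil s x with s = t ^ (k / j). *)
Lemma homnorm_layer_curve j k x (e : R) : (1 <= j)%N -> (1 <= k)%N -> layer G j x ->
  0 < e -> exists2 r, 0 < r & forall t, 0 <= t <= r -> n (t ^+ k *: x) <= e.
Proof.
move=> j1 k1 lx e0; pose e' := e / (n x + 1).
have nx1 : 0 < n x + 1 by rewrite ltr_wpDl // homnorm_ge0.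
have e'0 : 0 < e' by rewrite divr_gt0.
exists (Num.min 1 (e' ^+ j)) => [|t /andP[t0]]; first by rewrite lt_min ltr01 exprn_gt0.
rewrite le_min => /andP[t1 te].
pose s := (t ^+ k) `^ j%:R^-1.
have s0 : 0 <= s by exact: powR_ge0.
have sj : s ^+ j = t ^+ k.
  rewrite -powR_mulrn // /s -powRrM mulVf ?powRr1 ?exprn_ge0 //.
  by rewrite pnatr_eq0 -lt0n.
have -> : t ^+ k *: x = dil s x by rewrite (@dil_layer _ _ s j) // sj.
rewrite homnorm_dil //; have se : s <= e'.
  rewrite -(@ler_pXn2r _ j) ?nnegrE ?(ltW e'0) // sj (le_trans _ te) //.
  by case: k k1 {s s0 sj} => // k _; rewrite exprS ler_piMr // exprn_ile1.
rewrite (le_trans (ler_wpM2r (homnorm_ge0 nP x) se)) // /e' mulrAC ler_pdivrMr //.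
by apply: ler_wpM2l; [exact: ltW|rewrite lerDl].
Qed.

(** The monomials of layer [j] are divided off from the left one at a time. Each division alters the
    rest only by a curve in [filt j.+1], to which the induction on the layer applies. *)
Lemma homnorm_poly_curve j p (e : R) : (1 <= j)%N -> poly_curve j p -> p 0 = 0 ->
  0 < e -> exists2 r, 0 < r & forall t, 0 <= t <= r -> n (p t) <= e.
Proof.
have [m] := ubnP (step G + 1 - j)%N; elim: m j p e => [//|m IH] j p e hm j1 pp p0 e0.
have [sj|js] := ltnP (step G) j.
  have {}pp t : p t = 0.
    elim: pp {p0} => [k x fx|p1 p2 _ IH1 _ IH2]; last by rewrite IH1 IH2 addr0.
    suff -> : x = 0 by rewrite scaler0.
    apply: eq_proj => i hi; rewrite proj0 // fx //.
    by rewrite (leq_ltn_trans _ sj) //; case/andP: hi.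
  by exists 1 => // t _; rewrite pp homnorm0 ltW.
have hj : (1 <= j <= step G)%N by rewrite j1.
have {}IH q e' : poly_curve j.+1 q -> q 0 = 0 -> 0 < e' ->
    exists2 r, 0 < r & forall t, 0 <= t <= r -> n (q t) <= e'.
  by apply: IH => //; move: hm js; clear; lia.
have [s [r [hs pr E]]] := poly_curve_split hj pp.
pose s' := [seq kh <- s | (0 < kh.1)%N].
have ev0 (s0 : seq (nat * G)) :
    \sum_(kh <- s0) (0 : R) ^+ kh.1 *: kh.2 = \sum_(kh <- s0 | kh.1 == 0%N) kh.2.
  rewrite [RHS]big_mkcond; apply: eq_bigr => -[[|k] h] _ /=.
    by rewrite expr0 scale1r.
  by rewrite expr0n scale0r.
have r_proj t : proj j (r t) = 0.
  elim: pr {E} => [k x fx|p1 p2 _ IH1 _ IH2]; last by rewrite projD // IH1 IH2 addr0.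
  by rewrite projZ // fx // scaler0.
(* The constant monomials of layer j add up to 0 because p 0 = 0, so only positive powers of t
   remain in [s']. *)
have H0 : \sum_(kh <- s | kh.1 == 0%N) kh.2 = 0.
  have l0 : layer G j (\sum_(kh <- s | kh.1 == 0%N) kh.2).
    rewrite big_seq_cond; apply: big_ind => [|a b la lb|kh /andP[khs _]].
    - exact: layer0.
    - by rewrite -[a]scale1r; exact: layerP.
    - exact: hs.
  have := congr1 (proj j) (E 0); rewrite p0 ev0 projD // r_proj addr0 proj0 //.
  by rewrite (proj_of_layer hj j1 l0) eqxx.
have r0 : r 0 = 0 by have := E 0; rewrite p0 ev0 H0 add0r.
have {}E t : p t = \sum_(kh <- s') t ^+ kh.1 *: kh.2 + r t.
  rewrite E; congr (_ + _); rewrite big_filter (bigID (fun kh => 0 < kh.1)%N) /=.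
  rewrite [X in _ + X](eq_bigl (fun kh => kh.1 == 0%N)); last by move=> kh; rewrite -eqn0Ngt.
  rewrite [X in _ + X](eq_bigr (fun kh => kh.2)) ?H0 ?addr0 // => kh /eqP ->.
  by rewrite expr0 scale1r.
have {}hs kh : kh \in s' -> (0 < kh.1)%N /\ layer G j kh.2.
  by rewrite mem_filter => /andP[k0 /hs].
clearbody s'; clear s H0 ev0 r_proj.
elim: s' p r e hs pp p0 E pr r0 e0 => [|[k h] s IHs] p r e hs pp p0 E pr r0 e0.
  have [q q0 Hq] := IH r e pr r0 e0; exists q => // t ht.
  by rewrite E big_nil add0r; exact: Hq.
have [k0 lh] := hs (k, h) (mem_head _ _).
pose x t := t ^+ k *: h.
have px : poly_curve j x.
  apply: poly_curve_monom => i hi ij; rewrite (@proj_of_layer _ _ i j) //.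
  by rewrite ltn_eqF.
have x0 : x 0 = 0 by rewrite /x expr0n gtn_eqF // scale0r.
pose q t := gmul (- x t) (p t).
pose r' t := r t + (gmul (- x t) (p t) - (- x t + p t)).
have e2 : 0 < e / 2 by rewrite divr_gt0.
have [||||||a a0 Ha] := IHs q r' (e / 2) _ _ _ _ _ _ e2.
- by move=> kh khs; apply: hs; rewrite inE khs orbT.
- by apply: poly_curve_gmul => //; exact: poly_curveN.
- by rewrite /q x0 p0 oppr0 gmulx0.
- move=> t; rewrite /r' -/(q t).
  have -> : - x t + p t = \sum_(kh <- s) t ^+ kh.1 *: kh.2 + r t.
    by rewrite E big_cons /= -addrA addKr.
  by rewrite addrA addrC subrK.
- apply: poly_curveD => //.
  by apply: poly_curve_gmul_sub => //; exact: poly_curveN.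
- by rewrite /r' r0 x0 p0 oppr0 gmulx0 addr0 subrr ?addr0 ?add0r.
have [b b0 Hb] := homnorm_layer_curve j1 k0 lh e2.
exists (Num.min a b) => [|t /andP[t0]]; first by rewrite lt_min a0.
rewrite le_min => /andP[ta tb].
rewrite -[p t](gmulxK (x t)) (le_trans (homnorm_gmul nP _ _)) // [e]splitr lerD //.
  by apply: Hb; rewrite t0.
by apply: Ha; rewrite t0.
Qed.

Lemma homnorm_conj_curve z v (e : R) : layer G 1 v -> 0 < e ->
  exists2 r, 0 < r & forall t, 0 <= t <= r -> n (gmul (- z) (gmul (dil t v) z)) <= e.
Proof.
move=> lv e0; have f1 x : filt 1 x by case.
have [||r r0 Hr] := @homnorm_poly_curve 1 (fun t => gmul (- z) (gmul (t *: v) z)) e isT _ _ e0.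
- apply: poly_curve_gmul => //; first exact: poly_curve_cst.
  apply: poly_curve_gmul => //; last exact: poly_curve_cst.
  exact: (@poly_curve_ext _ _ _ (fun t => t ^+ 1 *: v)) (poly_curve_monom 1 (f1 v)).
- by rewrite scale0r gmul0x gmulNx.
by exists r => // t ht; rewrite (dil_layer _ _ lv) // expr1; exact: Hr.
Qed.

End HomNormCurves.

(** * Total boundedness, separability and porosity *)

Section HDist.
Context {R : realType} (G : bhGroup R) (n : G -> R).
Hypothesis nP : homnorm n.
Implicit Types x y z w : G.

Definition hdist x y : R := n (gmul (- x) y).

Lemma hdist_ge0 x y : 0 <= hdist x y.
Proof. exact: (homnorm_ge0 nP). Qed.

Lemma hdistC x y : hdist x y = hdist y x.
Proof. by rewrite /hdist -[LHS](homnormN nP) oppr_gmul opprK. Qed.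

Lemma hdist_triangle y x z : hdist x z <= hdist x y + hdist y z.
Proof.
have -> : hdist x z = n (gmul (gmul (- x) y) (gmul (- y) z)).
  by rewrite /hdist -gmulA gmulxK.
exact: (homnorm_gmul nP).
Qed.

Lemma hdist_left z x y : hdist (gmul z x) (gmul z y) = hdist x y.
Proof. by rewrite /hdist oppr_gmul -gmulA gmulKx. Qed.

Lemma hdist_dil t x y : 0 <= t -> hdist (dil t x) (dil t y) = t * hdist x y.
Proof. by move=> t0; rewrite /hdist -dilN -dil_gmul homnorm_dil. Qed.

Lemma hdistxx x : hdist x x = 0.
Proof. by rewrite /hdist gmulNx homnorm0. Qed.

Lemma hdist0x x : hdist 0 x = n x.
Proof. by rewrite /hdist oppr0 gmul0x. Qed.

Lemma hdist_gmulr x y : hdist x (gmul x y) = n y.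
Proof. by rewrite /hdist gmulKx. Qed.

Lemma hdist_eq0 x y : hdist x y = 0 -> x = y.
Proof. by move=> /(homnorm_eq0 nP) h; rewrite -[y](gmulxK x) h gmulx0. Qed.

Lemma conj_dil t z w : t != 0 -> gmul (- dil t z) (gmul w (dil t z)) =
  dil t (gmul (- z) (gmul (dil t^-1 w) z)).
Proof. by move=> t0; rewrite !dil_gmul dilN dilK. Qed.

(** Replaces right invariance: a small factor can be moved past a fixed z and remains small. *)
Definition homnorm_conj_cont := forall z (e : R), 0 < e ->
  exists2 r, 0 < r & forall w, n w <= r -> n (gmul (- z) (gmul w z)) <= e.

Lemma homnorm_big_gmul m (F : 'I_m -> G) :
  n (\big[@gmul R G/0]_(i < m) F i) <= \sum_(i < m) n (F i).
Proof.
elim/big_ind2: _ => [|a b c e ab ce|//]; first by rewrite homnorm0.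
by rewrite (le_trans (homnorm_gmul nP _ _)) // lerD.
Qed.

Lemma conj_big_gmul z m (F : 'I_m -> G) :
  gmul (- z) (gmul (\big[@gmul R G/0]_(i < m) F i) z) =
  \big[@gmul R G/0]_(i < m) gmul (- z) (gmul (F i) z).
Proof.
apply: (big_morph (fun w => gmul (- z) (gmul w z))) => [a b|].
  by rewrite -!gmulA gmulxK.
by rewrite gmul0x gmulNx.
Qed.

Lemma dil_big_gmul t m (F : 'I_m -> G) :
  dil t (\big[@gmul R G/0]_(i < m) F i) = \big[@gmul R G/0]_(i < m) dil t (F i).
Proof.
by apply: (big_morph (dil t)) => [a b|]; rewrite ?dil_gmul ?dilr0.
Qed.

Lemma grid (r t : R) k : 0 < r -> 0 <= t < k%:R * r ->
  exists2 j : nat, (j < k)%N & j%:R * r <= t < j.+1%:R * r.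
Proof.
move=> r0; elim: k => [|k IH] /andP[t0 tk].
  by move: tk; rewrite mul0r ltNge t0.
have [tk'|kt] := ltP t (k%:R * r); last by exists k => //; rewrite kt.
by have [|j jk hj] := IH; [rewrite t0|exists j => //; exact: ltnW].
Qed.

(** A grid for the first parameter is combined with a finite net for the other factors. The mesh is
    chosen after the net, so that the small first factor stays small when conjugated by each of the
    finitely many net points. *)
Lemma totally_bounded_products m (v : 'I_m -> G) (T e : R) :
  (forall i, layer G 1 (v i)) -> 0 < T -> 0 < e ->
  exists s : seq G, forall t : 'I_m -> R, (forall i, 0 <= t i < T) ->
    exists2 z, z \in s & hdist z (\big[@gmul R G/0]_(i < m) dil (t i) (v i)) <= e.
Proof.
move=> lv T0; elim: m v lv e => [|m IH] v lv e e0.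
  exists [:: 0] => t _; exists 0; rewrite ?mem_head //.
  by rewrite big_ord0 hdistxx ltW.
have e2 : 0 < e / 2 by rewrite divr_gt0.
have [s Hs] := IH (fun i => v (lift ord0 i)) (fun i => lv _) _ e2.
have [|z zs|r r0 Hr] := @seq_radius R G s (fun z r => forall t, 0 <= t <= r ->
    n (gmul (- z) (gmul (dil t (v ord0)) z)) <= e / 2).
- move=> z q r H qr t /andP[t0 tq]; apply: H; rewrite t0; exact: le_trans tq qr.
- exact: homnorm_conj_curve.
pose k := Num.bound (T / r).
exists [seq gmul (dil (j%:R * r) (v ord0)) z | j <- iota 0 k, z <- s] => t ht.
have [z zs hz] := Hs (fun i => t (lift ord0 i)) (fun i => ht _).
have /andP[t0 tT] := ht ord0.
have [|j jk /andP[jt tj]] := @grid r (t ord0) k r0.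
  rewrite t0 (lt_trans tT) // -ltr_pdivrMr //.
  by apply: archi_boundP; rewrite divr_ge0 // ltW.
exists (gmul (dil (j%:R * r) (v ord0)) z).
  by apply/allpairsP; exists (j, z); rewrite mem_iota.
rewrite big_ord_recl; set y := \big[_/_]_(_ < _) _ in hz *.
have -> : hdist (gmul (dil (j%:R * r) (v ord0)) z) (gmul (dil (t ord0) (v ord0)) y) =
    n (gmul (gmul (- z) (gmul (dil (t ord0 - j%:R * r) (v ord0)) z)) (gmul (- z) y)).
  rewrite /hdist oppr_gmul -!gmulA gmulxK; congr (n (gmul _ _)).
  rewrite !gmulA; congr gmul.
  by rewrite !(dil_layer _ _ (lv ord0)) // !expr1 -scaleNr gmulZ addrC.
rewrite (le_trans (homnorm_gmul nP _ _)) // [e]splitr lerD //.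
apply: (Hr z zs); rewrite subr_ge0 jt /= lerBlDl ltW // (lt_le_trans tj) //.
by rewrite -natr1 mulrDl mul1r.
Qed.

Section Spanning.
Variables (m : nat) (v : 'I_m -> G) (T : R).
Hypothesis v_layer : forall i, layer G 1 (v i).
Hypothesis T_gt0 : 0 < T.
Hypothesis v_span : forall x, n x < 1 -> exists2 t : 'I_m -> R,
  (forall i, 0 <= t i < T) & x = \big[@gmul R G/0]_(i < m) dil (t i) (v i).

Lemma span_scaled (r : R) x : 0 < r -> n x < r -> exists2 t : 'I_m -> R,
  (forall i, 0 <= t i < r * T) & x = \big[@gmul R G/0]_(i < m) dil (t i) (v i).
Proof.
move=> r0 xr; have [|t ht E] := v_span (x := dil r^-1 x).
  by rewrite homnorm_dil ?invr_ge0 ?ltW // mulrC ltr_pdivrMr // mul1r.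
exists (fun i => r * t i) => [i|].
  by have /andP[t0 tT] := ht i; rewrite mulr_ge0 ?(ltW r0) //= ltr_pM2l.
rewrite -[x](@dilK _ _ r) ?gt_eqF // E dil_big_gmul; apply: eq_bigr => i _.
by rewrite dil_dil.
Qed.

Lemma totally_bounded_ball (K e : R) : 0 < K -> 0 < e ->
  exists s : seq G, forall x, n x < K -> exists2 z, z \in s & hdist z x <= e.
Proof.
move=> K0 e0; have KT : 0 < K * T by rewrite mulr_gt0.
have [s Hs] := totally_bounded_products v_layer KT e0.
by exists s => x /(span_scaled K0)[t ht ->]; exact: Hs.
Qed.

(** A small w is a product of [m] short factors along the directions, and conjugation acts factor by
    factor. *)
Lemma span_conj_cont : homnorm_conj_cont.
Proof.
move=> z e e0; have m1 : 0 < m.+1%:R :> R by rewrite ltr0n.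
have em : 0 < e / m.+1%:R by rewrite divr_gt0.
have [|i _|r r0 Hr] := @seq_radius R 'I_m (enum 'I_m) (fun i r => forall t, 0 <= t <= r ->
    n (gmul (- z) (gmul (dil t (v i)) z)) <= e / m.+1%:R).
- move=> i q r H qr t /andP[t0 tq]; apply: H; rewrite t0; exact: le_trans tq qr.
- exact: homnorm_conj_curve.
exists (r / T / 2) => [|w wr]; first by rewrite !divr_gt0.
have [|t ht ->] := @span_scaled (r / T) w (divr_gt0 r0 T_gt0).
  by rewrite (le_lt_trans wr) // ltr_pdivrMr // mulr_natr mulr2n ltrDl divr_gt0.
rewrite conj_big_gmul (le_trans (homnorm_big_gmul _)) //.
rewrite (@le_trans _ _ (\sum_(i < m) e / m.+1%:R)) //.
  apply: ler_sum => i _; apply: Hr; first by rewrite mem_enum.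
  by have /andP[-> /ltW] := ht i; rewrite divfK // gt_eqF.
rewrite sumr_const card_ord -[leLHS]mulr_natr mulrAC ler_pdivrMr //.
by rewrite ler_wpM2l ?(ltW e0) // ler_nat.
Qed.

(** For each point of countably many finite nets, a nearby point of [A] is chosen if there is one,
    and 0 otherwise. The sequence may thus leave [A], whence the clause [A (a k)]. *)
Lemma span_separable (A : set G) : exists a : nat -> G, forall x, A x ->
  forall e : R, 0 < e -> exists2 k, A (a k) & hdist (a k) x <= e.
Proof.
have /choice[s Hs] : forall k : nat, exists s : seq G,
    forall x, n x < k.+1%:R -> exists2 z, z \in s & hdist z x <= k.+1%:R^-1.
  by move=> k; apply: totally_bounded_ball; rewrite ?invr_gt0 ltr0n.
have /choice[g Hg] : forall c : nat * nat, exists a : G,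
    (exists2 y, A y & hdist (nth 0 (s c.1) c.2) y <= c.1.+1%:R^-1) ->
    A a /\ hdist (nth 0 (s c.1) c.2) a <= c.1.+1%:R^-1.
  move=> c; case: (pselect (exists2 y, A y & hdist (nth 0 (s c.1) c.2) y <= c.1.+1%:R^-1)).
    by move=> [y Ay hy]; exists y.
  by move=> h; exists 0.
exists (fun k => g (odflt (0, 0)%N (unpickle k))) => x Ax e e0.
(* Serves both to put x in the ball of radius k + 1 and to make 2 / (k + 1) at most e. *)
pose k := Num.bound (n x + 2 / e).
have k_gt : n x + 2 / e < k%:R.
  by apply: archi_boundP; rewrite addr_ge0 ?homnorm_ge0 // divr_ge0 // ltW.
have [|z zs hz] := Hs k x.
  rewrite (le_lt_trans _ (lt_le_trans k_gt _)) ?ler_nat //.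
  by rewrite lerDl divr_ge0 // ltW.
have [] := Hg (k, index z (s k)); rewrite /= nth_index //; first by exists x.
move=> Ag hg; exists (pickle (k, index z (s k))); rewrite pickleK //=.
rewrite (le_trans (hdist_triangle z _ _)) // hdistC.
rewrite (le_trans (lerD hg hz)) // -mulr2n -[leLHS]mulr_natl ler_pdivrMr ?ltr0n //.
rewrite mulrC -ler_pdivrMr // (le_trans _ (ltW (lt_le_trans k_gt _))) ?ler_nat //.
by rewrite lerDr homnorm_ge0.
Qed.

End Spanning.

End HDist.

Section Porosity.
Context {R : realType} (T : Type) (d : T -> T -> R).
Hypothesis d_ge0 : forall x y, 0 <= d x y.
Hypothesis d_xx : forall x, d x x = 0.

(** Failure of porosity with every constant, in the form used below: [E] approximates all points
    near [x] to first order. *)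
Definition nonporous (E : set T) (x : T) := forall l : R, 0 < l ->
  exists2 r, 0 < r & forall y, d x y < r -> exists2 z, E z & d y z <= l * d x y.

Lemma nonporousP (E : set T) x : E x ->
  (forall k : nat, ~ porous_at d E (k.+1%:R^-1) x) -> nonporous E x.
Proof.
move=> Ex np l l0; apply: contrapT => H.
have /choice[y Hy] : forall k : nat, exists y, d x y < k.+1%:R^-1 /\
    forall z, E z -> l * d x y < d y z.
  move=> k; apply: contrapT => Hk; apply: H; exists k.+1%:R^-1; first by rewrite invr_gt0 ltr0n.
  move=> y yk; apply: contrapT => Hz; apply: Hk; exists y; split => // z Ez.
  by rewrite ltNge; apply/negP => h; apply: Hz; exists z.
pose k := Num.bound l^-1.
apply: (np k); exists y; split.
(* If y j were x, then x itself would be a point of [E] at distance 0 from it. *)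
- move=> j yx; have [_ /(_ x Ex)] := Hy j.
  by rewrite yx d_xx mulr0 ltxx.
- apply/cvgr0Pnorm_le => e e0; exists (Num.bound e^-1) => // j /= ej.
  rewrite ger0_norm //; have [/ltW h _] := Hy j; rewrite (le_trans h) //.
  rewrite invf_ple ?posrE ?ltr0n // ltW // (lt_le_trans (archi_boundP _)) //.
    by rewrite invr_ge0 ltW.
  by rewrite ler_nat leqW.
- move=> j; rewrite -subset0 => z []; rewrite /dball /= => h Ez.
  have [_ /(_ z Ez)] := Hy j; apply/negP; rewrite -leNgt.
  rewrite (le_trans (ltW h)) // ler_wpM2r // invf_ple ?posrE ?ltr0n //.
  rewrite ltW // (lt_le_trans (archi_boundP _)) ?invr_ge0 ?(ltW l0) //.
  by rewrite ler_nat.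
Qed.

Lemma porous_atS (E F : set T) l x : E `<=` F -> porous_at d F l x -> porous_at d E l x.
Proof.
move=> EF [y [yx yc yF]]; exists y; split=> // j.
by rewrite -subset0 => z [hz /EF Fz]; have : set0 z by rewrite -(yF j).
Qed.

(** With the constant 1 / (k + 1) fixed, the points of [E i] at which [E i] is porous form a porous
    set. The [option] provides the empty set for numbers that code no pair. *)
Lemma sigma_porous_points (I : countType) (E : I -> set T) :
  exists2 P, sigma_porous d P & forall x, ~ P x ->
    forall i, E i x -> nonporous (E i) x.
Proof.
pose F (c : option (I * nat)) := if c is Some (i, k) then
  [set x | E i x /\ porous_at d (E i) (k.+1%:R^-1) x] else set0.
exists (\bigcup_j F (odflt None (unpickle j))).
  exists (fun j => F (odflt None (unpickle j))) => // j.
  case: (odflt None (unpickle j)) => [[i k]|] /=; last by exists 1.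
  exists k.+1%:R^-1; first by rewrite invr_gt0 ltr0n.
  by move=> x [Ex]; apply: porous_atS => y [].
move=> x Px i Ex; apply: nonporousP => // k pk; apply: Px.
by exists (pickle (Some (i, k))) => //; rewrite pickleK.
Qed.

End Porosity.

(** * Uniform directional derivatives *)

Section UniformDerivative.
Context {R : realType} (G M : bhGroup R) (n : G -> R) (N : M -> R).
Hypotheses (nP : homnorm n) (NP : homnorm N).
Hypotheses (n_conj : homnorm_conj_cont n) (N_conj : homnorm_conj_cont N).
Variables (A : set G) (f : G -> M) (C : R).
Hypothesis C_gt0 : 0 < C.
Hypothesis f_lip : forall x y, A x -> A y -> hdist N (f x) (f y) <= C * hdist n x y.
Local Notation dG := (hdist n).
Local Notation dM := (hdist N).

Definition increment x y : M := gmul (- f x) (f (gmul x y)).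

(* [f] has approximate derivative [D] at [x] in the direction [zeta], with
   error [e] up to scale [r]; the Lipschitz term makes the condition stable
   under changes of the direction. *)
Definition approx_deriv (zeta : G) (D : M) (e r : R) : set G :=
  [set x | A x /\ forall t : R, 0 < t < r -> forall y, A (gmul x y) ->
    dM (dil t D) (increment x y) <= e * t + C * dG (dil t zeta) y].

Definition uniform_deriv x zeta D := forall e : R, 0 < e ->
  exists2 r, 0 < r & approx_deriv zeta D e r x.

Lemma increment_split x y z : increment x z =
  gmul (increment x y) (increment (gmul x y) (gmul (- y) z)).
Proof. by rewrite /increment -!gmulA !gmulxK. Qed.

Lemma approx_deriv_weaken zeta D e r zeta' D' e' r' x :
  dG zeta' zeta <= e' -> dM D' D <= e' -> e + (C + 1) * e' <= r' ->
  approx_deriv zeta D e r x -> approx_deriv zeta' D' r' r x.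
Proof.
move=> hz hD he [Ax H]; split=> // t tr y Ay; have /andP[t0 _] := tr.
rewrite (le_trans (hdist_triangle NP (dil t D) _ _)) // hdist_dil ?(ltW t0) //.
have h1 := H t tr y Ay.
have h2 := hdist_triangle nP (dil t zeta') (dil t zeta) y.
rewrite (hdist_dil nP) ?(ltW t0) // (hdistC nP zeta zeta') in h2.
have h3 := ler_wpM2l (ltW C_gt0) h2.
have h4 : t * dM D' D <= t * e' by rewrite ler_wpM2l // ltW.
have h5 : C * (t * dG zeta' zeta) <= C * (t * e').
  by rewrite ler_wpM2l ?(ltW C_gt0) // ler_wpM2l // ltW.
have h6 : t * (e + (C + 1) * e') <= t * r' by rewrite ler_wpM2l // ltW.
lra.
Qed.

Lemma nonporous_point x zeta (l : R) : nonporous (fun x y => dG x y) A x -> 0 < l ->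
  exists2 r, 0 < r & forall t, 0 < t < r -> exists2 y, A (gmul x y) &
    dG (dil t zeta) y <= l * t.
Proof.
(* [n zeta] is the distance from x to x (dil t zeta) divided by t; adding 1 allows division when
   zeta = 0. *)
move=> np l0; have nz : 0 < n zeta + 1 by rewrite ltr_wpDl // homnorm_ge0.
have [r r0 Hr] := np (l / (n zeta + 1)) (divr_gt0 l0 nz).
exists (r / (n zeta + 1)) => [|t /andP[t0 tr]]; first by rewrite divr_gt0.
have t0' := ltW t0.
have E : dG x (gmul x (dil t zeta)) = t * n zeta by rewrite hdist_gmulr homnorm_dil.
have h : t * n zeta <= t * (n zeta + 1) by rewrite ler_wpM2l // lerDl.
have [|z Az hz] := Hr (gmul x (dil t zeta)).
  by rewrite E (le_lt_trans h) // -ltr_pdivlMr.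
exists (gmul (- x) z); first by rewrite gmulxK.
rewrite -(hdist_left n x) gmulxK (le_trans hz) // E mulrAC ler_pdivrMr //.
by rewrite -mulrA ler_wpM2l // ltW.
Qed.

(** Supplies countably many candidate derivatives, the increments of [f] between points of the
    sequence, rescaled from t = 1 / (k + 1) to scale 1. *)
Lemma uniform_deriv_value_approx (a : nat -> G) x zeta D :
  (forall y, A y -> forall e : R, 0 < e -> exists2 k, A (a k) & dG (a k) y <= e) ->
  nonporous (fun x y => dG x y) A x -> uniform_deriv x zeta D ->
  forall e : R, 0 < e -> exists p q k : nat,
    dM (dil k.+1%:R (gmul (- f (a p)) (f (a q)))) D <= e.
Proof.
move=> sep np H e e0.
have e4 : 0 < e / 4 by rewrite divr_gt0.
have [r1 r10 [Ax H1]] := H _ e4.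
have l0 : 0 < e / 4 / C by rewrite divr_gt0.
have [r2 r20 H2] := nonporous_point zeta np l0.
pose r := Num.min r1 r2; have r0 : 0 < r by rewrite lt_min r10.
pose k := Num.bound r^-1; pose t : R := k.+1%:R^-1.
have t0 : 0 < t by rewrite invr_gt0 ltr0n.
have t0' := ltW t0.
have : t < r.
  rewrite invf_plt ?posrE ?ltr0n // (lt_trans (archi_boundP _)) ?invr_ge0 ?(ltW r0) //.
  by rewrite ltr_nat.
rewrite lt_min => /andP[tr1 tr2].
have [|y Ay hy] := H2 t; first by rewrite t0.
have k1 : dM (dil t D) (increment x y) <= t * (e / 2).
  have := H1 t; rewrite t0 tr1 => /(_ isT y Ay) k1.
  have k2 := ler_wpM2l (ltW C_gt0) hy.
  have k3 : C * (e / 4 / C * t) = e / 4 * t by rewrite mulrCA mulrA divfK ?gt_eqF // mulrC.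
  by rewrite (le_trans k1) //; lra.
set w := increment x y in k1.
have te4 : 0 < t * (e / 4) by rewrite mulr_gt0.
(* Replacing x by a p alters the increment w on its left, which costs a conjugation by w; hence p is
   chosen after w. *)
have [s s0 Hs] := N_conj w te4.
have [p Ap hp] := sep x Ax (s / C) (divr_gt0 s0 C_gt0).
have [q Aq hq] := sep _ Ay (t * (e / 4) / C) (divr_gt0 te4 C_gt0).
exists p, q, k; set w' := gmul _ _.
have k2 : dM w' w <= t * (e / 2).
  have -> : dM w' w = N (gmul (gmul (- f (a q)) (f (gmul x y)))
      (gmul (- w) (gmul (gmul (- f x) (f (a p))) w))).
    rewrite /hdist /w' /w /increment !oppr_gmul !opprK -!gmulA.
    by rewrite gmulxK gmulxK.
  have -> : t * (e / 2) = t * (e / 4) + t * (e / 4) by field.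
  rewrite (le_trans (homnorm_gmul NP _ _)) // lerD //.
    by rewrite (le_trans (f_lip Aq Ay)) // mulrC -ler_pdivlMr.
  apply: Hs; rewrite -/(hdist N _ _) (hdistC NP) (le_trans (f_lip Ap Ax)) //.
  by rewrite mulrC -ler_pdivlMr.
have -> : k.+1%:R = t^-1 by rewrite invrK.
rewrite -[D](@dilVK _ _ t) ?gt_eqF // hdist_dil ?invr_ge0 // ler_pdivrMl //.
rewrite (le_trans (hdist_triangle NP w _ _)) // (hdistC NP w).
by rewrite (le_trans (lerD k2 k1)) // -mulrDr -splitr.
Qed.

(** Both derivatives are compared with the increment to a single point of [A] near x (dil t zeta).
    The case zeta = zeta' gives uniqueness. *)
Lemma uniform_deriv_lip x zeta zeta' D D' : nonporous (fun x y => dG x y) A x ->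
  uniform_deriv x zeta D -> uniform_deriv x zeta' D' -> dM D D' <= C * dG zeta zeta'.
Proof.
move=> np H H'; apply/ler_addgt0Pr => e e0.
have e4 : 0 < e / 4 by rewrite divr_gt0.
have [r1 r10 [_ H1]] := H _ e4.
have [r2 r20 [_ H2]] := H' _ e4.
have l0 : 0 < e / 4 / C by rewrite divr_gt0.
have [r3 r30 H3] := nonporous_point zeta np l0.
pose t := Num.min r1 (Num.min r2 r3) / 2.
have m0 : 0 < Num.min r1 (Num.min r2 r3) by rewrite !lt_min r10 r20.
have t0 : 0 < t by rewrite divr_gt0.
have tm : t < Num.min r1 (Num.min r2 r3) by rewrite ltr_pdivrMr // mulr_natr mulr2n ltrDl.
move: tm; rewrite !lt_min => /and3P[t1 t2 t3].
have [|y Ay hy] := H3 t; first by rewrite t0.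
have k1 := H1 t; rewrite t0 t1 in k1; have {}k1 := k1 isT y Ay.
have k2 := H2 t; rewrite t0 t2 in k2; have {}k2 := k2 isT y Ay.
have k3 := hdist_triangle NP (increment x y) (dil t D) (dil t D').
rewrite (hdist_dil NP) ?(ltW t0) // (hdistC NP (increment x y)) in k3.
have k4 := hdist_triangle nP (dil t zeta) (dil t zeta') y.
rewrite (hdist_dil nP) ?(ltW t0) // (hdistC nP zeta' zeta) in k4.
have k5 := ler_wpM2l (ltW C_gt0) k4.
have k6 : C * dG (dil t zeta) y <= e / 4 * t.
  rewrite (le_trans (ler_wpM2l (ltW C_gt0) hy)) // mulrA [C * _]mulrC.
  by rewrite divfK // gt_eqF.
rewrite -(ler_pM2l t0); lra.
Qed.

Lemma uniform_deriv0 x : A x -> uniform_deriv x 0 0.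
Proof.
move=> Ax e e0; exists 1 => //; split=> // t /andP[t0 _] y Ay.
rewrite !dilr0 !hdist0x (le_trans (f_lip Ax Ay)) //.
by rewrite hdist_gmulr lerDr mulr_ge0 // ltW.
Qed.

Lemma uniform_deriv_dil x zeta D s : A x -> 0 <= s ->
  uniform_deriv x zeta D -> uniform_deriv x (dil s zeta) (dil s D).
Proof.
move=> Ax; rewrite le_eqVlt => /orP[/eqP <- _|s0 H e e0].
  by rewrite !dil0; exact: uniform_deriv0.
have [r r0 [_ Hr]] := H (e / s) (divr_gt0 e0 s0).
exists (r / s); first by rewrite divr_gt0.
split=> // t /andP[t0 tr] y Ay; rewrite !dil_dil.
have ts : 0 < t * s < r by rewrite mulr_gt0 //= -ltr_pdivlMr.
rewrite (le_trans (Hr _ ts y Ay)) // lerD2r.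
by rewrite mulrCA divfK ?gt_eqF // mulrC.
Qed.

(* Non-porosity of the set of good points provides a good point near
   x (dil t zeta), from which the increment in the direction eta is controlled. *)
Lemma uniform_deriv_gmul x zeta eta a b : A x ->
  (forall e, 0 < e -> exists eta' b' e' r, [/\ 0 < r, e' <= e,
     nonporous (fun x y => dG x y) (approx_deriv eta' b' e' r) x,
     dG eta' eta <= e & dM b' b <= e]) ->
  uniform_deriv x zeta a -> uniform_deriv x (gmul zeta eta) (gmul a b).
Proof.
move=> Ax Hb Ha e e0.
have e4 : 0 < e / 4 by rewrite divr_gt0.
have [r1 r10 Hr1] := N_conj b e4.
have eC : 0 < e / 4 / C by rewrite divr_gt0.
have [r2 r20 Hr2] := n_conj eta eC.
have C2 : 0 < C + 2 by rewrite addr_gt0.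
(* This error occurs once through e', once through b' and [C] times through eta'. *)
have e1 : 0 < e / 4 / (C + 2) by rewrite divr_gt0.
have [eta' [b' [e' [r' [r'0 e'e1 np hE hB]]]]] := Hb _ e1.
have nz : 0 < n zeta + 1 by rewrite ltr_wpDl // homnorm_ge0.
(* Writing x' = x (dil t zeta) w with n w <= m t, the bound r2 makes w cost at most t e / (4 C)
   after conjugation by [dil t eta]. The other bound gives N u <= t r1 for the error u of the
   increment to x', which then costs at most t e / 4 after conjugation by [dil t b]. *)
pose m := Num.min r2 (r1 / 2 / C).
have m0 : 0 < m by rewrite lt_min r20 !divr_gt0.
have [r3 r30 Hr3] := np (m / (n zeta + 1)) (divr_gt0 m0 nz).
have [r4 r40 [_ Hr4]] := Ha (r1 / 2) (divr_gt0 r10 (ltr0Sn _ _)).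
exists (Num.min (Num.min r' r4) (r3 / (n zeta + 1))).
  by rewrite !lt_min r'0 r40 divr_gt0.
split=> // t; rewrite !lt_min => /andP[t0 /andP[/andP[tr' tr4] tr3]] y Ay.
have t0' := ltW t0; have tn0 : t != 0 by rewrite gt_eqF.
have E : dG x (gmul x (dil t zeta)) = t * n zeta by rewrite hdist_gmulr homnorm_dil.
have hz : t * n zeta <= t * (n zeta + 1) by rewrite ler_wpM2l // lerDl.
have [|x' [Ax' Hx'] hx'] := Hr3 (gmul x (dil t zeta)).
  by rewrite E (le_lt_trans hz) // -ltr_pdivlMr.
pose w := gmul (- dil t zeta) (gmul (- x) x').
have nw : n w <= m * t.
  have -> : n w = dG (gmul x (dil t zeta)) x' by rewrite /hdist oppr_gmul -gmulA.
  rewrite (le_trans hx') // E mulrAC ler_pdivrMr // -mulrA ler_wpM2l //.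
  exact: ltW.
have xE : x' = gmul x (gmul (dil t zeta) w) by rewrite /w gmulxK gmulxK.
pose y1 := gmul (dil t zeta) w.
have Ay1 : A (gmul x y1) by rewrite -xE.
have tt4 : 0 < t < r4 by rewrite t0.
have tt' : 0 < t < r' by rewrite t0.
have ka := Hr4 t tt4 y1 Ay1.
rewrite (hdist_gmulr n) in ka.
pose u := gmul (- dil t a) (increment x y1).
have nu : N u <= t * r1.
  have k : C * n w <= r1 / 2 * t.
    rewrite (le_trans (ler_wpM2l (ltW C_gt0) nw)) // mulrA ler_wpM2r //.
    by rewrite mulrC -ler_pdivlMr // /m ge_min lexx orbT.
  rewrite (le_trans ka) //; lra.
pose y2 := gmul (- y1) y.
have Ay2 : A (gmul x' y2) by rewrite xE -/y1 /y2 -gmulA gmulxK.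
have kb := Hx' t tt' y2 Ay2.
have ke := ler_wpM2r t0' e'e1.
have kb2 : dG (dil t eta') y2 <= t * (e / 4 / (C + 2)) + (t * (e / 4 / C) +
    dG (dil t (gmul zeta eta)) y).
  rewrite (le_trans (hdist_triangle nP (dil t eta) _ _)) // lerD //.
    by rewrite hdist_dil // ler_wpM2l.
  have -> : dG (dil t eta) y2 = n (gmul (gmul (- dil t eta) (gmul (- w) (dil t eta)))
      (gmul (- dil t (gmul zeta eta)) y)).
    rewrite /hdist /y2 /y1 dil_gmul !oppr_gmul -!gmulA; congr (n (gmul _ (gmul _ _))).
    by rewrite gmulxK.
  rewrite (le_trans (homnorm_gmul nP _ _)) // lerD2r conj_dil // homnorm_dil //.
  rewrite ler_wpM2l // Hr2 // homnorm_dil ?invr_ge0 // homnormN // mulrC ler_pdivrMr //.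
  by rewrite (le_trans nw) // ler_wpM2r // /m ge_min lexx.
have kM : dM (dil t (gmul a b)) (increment x y) <= t * (e / 4) +
    (t * (e / 4 / (C + 2)) + dM (dil t b') (increment x' y2)).
  have -> : dM (dil t (gmul a b)) (increment x y) =
      N (gmul (gmul (- dil t b) (gmul u (dil t b)))
        (gmul (- dil t b) (increment x' y2))).
    rewrite /hdist (increment_split x y1 y) -xE -/y2 dil_gmul oppr_gmul -!gmulA.
    by rewrite gmulxK.
  rewrite (le_trans (homnorm_gmul NP _ _)) // lerD //.
    rewrite conj_dil // homnorm_dil // ler_wpM2l // Hr1 // homnorm_dil ?invr_ge0 //.
    by rewrite mulrC ler_pdivrMr // mulrC.
  rewrite -/(hdist N _ _) (le_trans (hdist_triangle NP (dil t b') _ _)) // lerD2r.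
  by rewrite hdist_dil // ler_wpM2l // hdistC.
have kb3 := ler_wpM2l (ltW C_gt0) kb2.
set q := e / 4 / (C + 2) in ke kb2 kb3 kM.
have hq : (C + 2) * q = e / 4 by rewrite mulrC /q divfK // gt_eqF.
have hp : C * (e / 4 / C) = e / 4 by rewrite mulrC divfK // gt_eqF.
set p := e / 4 / C in hp kb2 kb3.
set s := dG (dil t (gmul zeta eta)) y in kb2 kb3 *.
have hq' : t * ((C + 2) * q) = t * (e / 4) by rewrite hq.
have hp' : t * (C * p) = t * (e / 4) by rewrite hp.
have te : 0 <= t * e by rewrite mulr_ge0 // ltW.
move: (dM (dil t (gmul a b)) _) (dM (dil t b') _) (dG (dil t eta') y2) kM kb kb3.
by move: ke hq' hp' te; clear; move=> *; lra.
Qed.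

(** One approximating curve suffices: passing from [z t] to another point y costs [C] times their
    distance, which the Lipschitz term of [approx_deriv] absorbs. *)
Lemma uniform_deriv_of_curve x zeta D (z : R -> G) :
  A x -> (forall t, 0 < t -> A (gmul x (z t))) ->
  (forall e, 0 < e -> exists2 r, 0 < r & forall t, 0 < t < r ->
     dG (dil t zeta) (z t) <= e * t /\
     N (gmul (- D) (dil t^-1 (increment x (z t)))) <= e) ->
  uniform_deriv x zeta D.
Proof.
move=> Ax Az H e e0.
have C1 : 0 < C + 1 by rewrite addr_gt0.
have [r r0 Hr] := H _ (divr_gt0 e0 C1); exists r => //; split=> // t tr y Ay.
have /andP[t0 _] := tr; have t0' := ltW t0.
have [h1 h2] := Hr t tr.
have k1 : dM (dil t D) (increment x (z t)) <= t * (e / (C + 1)).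
  rewrite -[increment x (z t)](@dilK _ _ t) ?gt_eqF // hdist_dil //.
  by rewrite ler_wpM2l.
have k2 : dM (increment x (z t)) (increment x y) <= C * dG (z t) y.
  rewrite /increment (hdist_left N) -[dG (z t) y](hdist_left n x).
  by apply: f_lip => //; exact: Az.
have k3 := hdist_triangle NP (increment x (z t)) (dil t D) (increment x y).
have k4 := hdist_triangle nP (dil t zeta) (z t) y.
rewrite (hdistC nP (z t) (dil t zeta)) in k4.
have k5 := ler_wpM2l (ltW C_gt0) k4.
have k6 := ler_wpM2l (ltW C_gt0) h1.
set q := e / (C + 1) in h1 h2 k1 k6.
have hq : (C + 1) * q = e by rewrite mulrC /q divfK // gt_eqF.
have {}hq : t * ((C + 1) * q) = t * e by rewrite hq.
move: (dM (dil t D) (increment x y)) (dM (dil t D) (increment x (z t)))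
  (dM (increment x (z t)) (increment x y)) (dG (z t) y) (dG (dil t zeta) y)
  (dG (dil t zeta) (z t)) k1 k2 k3 k5 k6.
by move: hq; clear; move=> *; lra.
Qed.

(** The scale is made independent of the direction by a finite net in a ball containing the unit
    sphere; between net points, L is controlled by [uniform_deriv_lip]. *)
Lemma uniform_deriv_hdiff x : A x -> nonporous (fun x y => dG x y) A x ->
  (forall zeta, exists D, uniform_deriv x zeta D) ->
  (forall zeta eta a b, uniform_deriv x zeta a -> uniform_deriv x eta b ->
     uniform_deriv x (gmul zeta eta) (gmul a b)) ->
  (forall e : R, 0 < e -> exists s : seq G, forall y, n y < 2 ->
     exists2 z, z \in s & dG z y <= e) ->
  exists2 L : G -> M, h_homomorphism L &
    forall e : R, 0 < e -> exists2 r, 0 < r & forall z, A (gmul x z) ->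
      0 < n z < r -> dM (increment x z) (L z) / n z < e.
Proof.
move=> Ax np /choice[L HL] Hmul tb.
have Luniq zeta D : uniform_deriv x zeta D -> L zeta = D.
  move=> HD; apply: (hdist_eq0 NP); apply/eqP; rewrite eq_le (hdist_ge0 NP) andbT.
  by rewrite (le_trans (uniform_deriv_lip np (HL zeta) HD)) // (hdistxx nP) mulr0.
exists L.
  split=> [y z|r y r0]; first by apply: Luniq; exact: Hmul.
  by apply: Luniq; apply: uniform_deriv_dil => //; exact: ltW.
(* The errors add up to (2 C + 1) e' t; one more unit makes the final inequality strict. *)
move=> e e0; have C2 : 0 < C + C + 2 by rewrite !addr_gt0.
pose e' := e / (C + C + 2); have e'0 : 0 < e' by rewrite divr_gt0.
have [s Hs] := tb _ e'0.
have [|zeta _|r r0 Hr] := @seq_radius R G s (fun zeta r => approx_deriv zeta (L zeta) e' r x).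
- move=> zeta q r [_ H] qr; split=> // t /andP[t0 tq]; apply: H.
  by rewrite t0 (lt_le_trans tq).
- exact: HL.
exists r => // z Az /andP[z0 zr].
set t := n z in z0 zr *.
have t0' := ltW z0; have tn0 : t != 0 by rewrite gt_eqF.
pose y := dil t^-1 z.
have zE : z = dil t y by rewrite dilK.
have [|zeta zs hz] := Hs y.
  by rewrite /y homnorm_dil ?invr_ge0 // mulVf // ltr1n.
have [_ H] := Hr zeta zs.
have tr : 0 < t < r by rewrite z0.
have k1 := H t tr z Az.
have k2 : dM (dil t (L zeta)) (L z) <= t * (C * e').
  rewrite {1}zE (Luniq _ _ (uniform_deriv_dil Ax t0' (HL y))) hdist_dil // ler_wpM2l //.
  rewrite (le_trans (uniform_deriv_lip np (HL zeta) (HL y))) //.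
  by rewrite ler_wpM2l // ltW.
have k3 : dG (dil t zeta) z <= t * e' by rewrite zE hdist_dil // ler_wpM2l.
have k4 := ler_wpM2l (ltW C_gt0) k3.
have k5 := hdist_triangle NP (dil t (L zeta)) (increment x z) (L z).
rewrite (hdistC NP (increment x z) (dil t _)) in k5.
rewrite ltr_pdivrMr //.
have he : (C + C + 2) * e' = e by rewrite mulrC /e' divfK // gt_eqF.
have te : 0 < t * e' by rewrite mulr_gt0.
rewrite -he; lra.
Qed.

End UniformDerivative.

(** * The exceptional set and differentiability outside it *)

Lemma at_right0P (R : realType) (P : R -> Prop) :
  (\forall t \near 0^'+, P t) -> exists2 r, 0 < r & forall t, 0 < t < r -> P t.
Proof.
move=> /nbhs_ballP[r /= r0 H]; exists r => // t /andP[t0 tr].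
by apply: H => //; rewrite /ball /= sub0r normrN gtr0_norm.
Qed.

Theorem mainTheorem3 (R : realType)
    (G : bhGroup R) (G_stratified : stratified G)
    (d : G -> G -> R) (d_homogeneous : homogeneous_distance d)
    (mu : {measure set (borelType G) -> \bar R}) (mu_haar : haar_measure mu)
    (M : bhGroup R)
    (sigma : nat -> R) (sigma_constants : norm_constants M sigma)
    (A : set G) (A_measurable : mu_measurable mu A)
    (f : G -> M) (f_lipschitz : lipschitz_within d (bh_dist sigma) A f) :
  exists2 P : set G, sigma_porous d P &
    forall x : G, ((A `&` density_point d mu A) `\` P) x ->
      (exists (N : nat) (v : 'I_N -> G), spanning_directions d v /\
         forall i, directionally_differentiable d A f x (v i)) ->
      h_differentiable d (bh_dist sigma) A f x.
Proof.
(* [P] is chosen before the point and its directions. If no spanning set exists, the claim is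
   vacuous; otherwise any fixed one yields the separability and the continuity of conjugation needed
   to build [P]. *)
case: (pselect (exists (m : nat) (v : 'I_m -> G), spanning_directions d v)); last first.
  move=> nospan; exists set0.
    exists (fun=> set0); first by move=> k; exists 1.
    by rewrite bigcup_const.
  by move=> x _ [m [v [sv _]]]; case: nospan; exists m, v.
move=> [m [v [v_layer [T T0 v_span]]]].
pose n (y : G) := d y 0; pose N := @bh_norm R M sigma.
have nP : homnorm n := homnorm_hdist d_homogeneous.
have NP : homnorm N := homnorm_bh_norm sigma_constants.
have [[d_ge0 d_eq0] dC _ _ _] := d_homogeneous.
have dE y z : d y z = hdist n y z by rewrite (hdistC nP); exact: hdist_gmul.
have d_xx y : d y y = 0 by exact/d_eq0.
have span k (w : 'I_k -> G) S : dball d 0 1 `<=` [set \big[@gmul R G/0]_(i < k) dil (t i) (w i) |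
      t in [set t : 'I_k -> R | forall i, 0 <= t i < S]] ->
    forall y, n y < 1 -> exists2 t : 'I_k -> R, (forall i, 0 <= t i < S) &
      y = \big[@gmul R G/0]_(i < k) dil (t i) (w i).
  by move=> H y y1; have [|t ht <-] := H y; [rewrite /dball /= dC|exists t].
have {}v_span := span _ _ _ v_span.
have n_conj : homnorm_conj_cont n := span_conj_cont nP v_layer T0 v_span.
have N_conj : homnorm_conj_cont N by move=> b e; exact: bh_norm_conj.
have [C0 f_lip0] := f_lipschitz; pose C := Num.max C0 1.
have C_gt0 : 0 < C by rewrite lt_max ltr01 orbT.
have f_lip y z : A y -> A z -> hdist N (f y) (f z) <= C * hdist n y z.
  move=> Ay Az; rewrite (le_trans (f_lip0 y z Ay Az)) // -dE ler_wpM2r //.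
  by rewrite le_max lexx.
have [a Ha] := span_separable nP v_layer T0 v_span setT.
have [a' Ha'] := span_separable nP v_layer T0 v_span A.
(* Here i codes the direction, (p, q, k) the derivative, j the error and l the scale; [None] stands
   for [A]. *)
pose E (c : option (nat * nat * nat * nat * nat * nat)) : set G :=
  if c is Some (i, p, q, k, j, l) then
    approx_deriv n N A f C (a i) (dil k.+1%:R (gmul (- f (a' p)) (f (a' q))))
      j.+1%:R^-1 l.+1%:R^-1
  else A.
have [P porP HP] := sigma_porous_points d_ge0 d_xx E.
exists P => // x [[Ax _] Px] [k [w [[w_layer [S S0 w_span]] w_diff]]].
have {}HP c : E c x -> nonporous (hdist n) (E c) x.
  move=> Ec l l0; have [r r0 Hr] := HP x Px c Ec l l0; exists r => // y.
  by rewrite -!dE => /Hr[z Ez hz]; exists z; rewrite // -dE.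
have npA : nonporous (hdist n) A x := HP None Ax.
pose U := uniform_deriv n N A f C x.
have C1 : 0 < C + 1 by rewrite addr_gt0.
have approx zeta D : U zeta D -> forall e, 0 < e -> exists eta' b' e' r,
    [/\ 0 < r, e' <= e, nonporous (hdist n) (approx_deriv n N A f C eta' b' e' r) x,
      hdist n eta' zeta <= e & hdist N b' D <= e].
  move=> UD e e0.
  have inv_bound (r : R) : 0 < r -> (Num.bound r^-1).+1%:R^-1 <= r.
    move=> r0; rewrite invf_ple ?posrE ?ltr0n // ltW //.
    by rewrite (lt_trans (archi_boundP _)) ?ltr_nat // invr_ge0 ltW.
  pose j := Num.bound e^-1; have je : j.+1%:R^-1 <= e := inv_bound e e0.
  have j0 : 0 < j.+1%:R^-1 :> R by rewrite invr_gt0 ltr0n.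
  (* Chosen so that 1 / (2 (j + 1)) + (C + 1) e1 = 1 / (j + 1), as [approx_deriv_weaken]
     requires. *)
  pose e1 := j.+1%:R^-1 / 2 / (C + 1).
  have e10 : 0 < e1 by rewrite !divr_gt0.
  have e1j : e1 <= j.+1%:R^-1.
    rewrite /e1 !ler_pdivrMr //; set u := _^-1 in j0 *.
    have uC : 0 < u * C by rewrite mulr_gt0.
    by lra.
  have [i _ hi] := Ha zeta I e1 e10.
  have [p [q [k' hD]]] := uniform_deriv_value_approx nP NP N_conj C_gt0 f_lip Ha' npA UD e10.
  have [r r0 Hr] := UD _ (divr_gt0 j0 (ltr0Sn _ 1)).
  pose l := Num.bound r^-1; have lr : l.+1%:R^-1 <= r := inv_bound r r0.
  exists (a i), (dil k'.+1%:R (gmul (- f (a' p)) (f (a' q)))), j.+1%:R^-1, l.+1%:R^-1.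
  split=> //.
  - apply: (HP (Some (i, p, q, k', j, l))) => /=.
    have [_ Hw] : approx_deriv n N A f C (a i)
        (dil k'.+1%:R (gmul (- f (a' p)) (f (a' q)))) j.+1%:R^-1 r x.
      apply: (approx_deriv_weaken nP NP C_gt0 hi hD _ Hr).
      by rewrite /e1 [X in _ + X]mulrC divfK ?gt_eqF // -splitr.
    split=> // t /andP[t0 tl]; apply: Hw; rewrite t0; exact: lt_le_trans tl lr.
  - exact: le_trans hi (le_trans e1j je).
  - exact: le_trans hD (le_trans e1j je).
have U_gmul zeta eta b1 b2 : U zeta b1 -> U eta b2 -> U (gmul zeta eta) (gmul b1 b2).
  move=> U1 U2.
  exact: (uniform_deriv_gmul nP NP n_conj N_conj C_gt0 Ax (approx _ _ U2) U1).
have U_w i : exists D, U (w i) D.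
  have [[z [Az z_lim]] [D HD]] := w_diff i; exists D.
  apply: (uniform_deriv_of_curve nP NP C_gt0 f_lip Ax Az) => e e0.
  have [r1 r10 H1] := at_right0P (cvg_bh_norm sigma_constants (HD z (conj Az z_lim)) e0).
  have [r2 r20 H2] : exists2 r, 0 < r & forall t, 0 < t < r -> `|d (z t) (dil t (w i)) / t| <= e.
    apply: (at_right0P (P := fun t => `|d (z t) (dil t (w i)) / t| <= e)).
    by move/cvgr0Pnorm_le: z_lim; exact.
  exists (Num.min r1 r2) => [|t]; first by rewrite lt_min r10.
  rewrite lt_min => /andP[t0 /andP[t1 t2]]; split; last by apply: H1; rewrite t0.
  have := H2 t; rewrite t0 t2 => /(_ isT).
  by rewrite ger0_norm ?divr_ge0 ?(ltW t0) // ler_pdivrMr // dC dE.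
have U_all zeta : exists D, U zeta D.
  have z1 : 0 < n zeta + 1 by rewrite ltr_wpDl // homnorm_ge0.
  have [|t ht ->] := span_scaled nP (span _ _ _ w_span) (x := zeta) z1.
    by rewrite ltrDl.
  apply: (big_ind (fun y => exists D, U y D)) => [|y z [D1 U1] [D2 U2]|i _].
  - by exists 0; exact: uniform_deriv0.
  - by exists (gmul D1 D2); exact: U_gmul.
  - have [D UD] := U_w i; exists (dil (t i) D).
    by apply: uniform_deriv_dil => //; have /andP[] := ht i.
have [e e0|L Lhom HL] := uniform_deriv_hdiff nP NP C_gt0 f_lip Ax npA U_all U_gmul.
  exact: totally_bounded_ball v_span _ _ _ e0.
by exists L.
Qed.
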